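(* For $0<z<\frac{\pi}{2}$, the following three identities hold: $$\operatorname{ls}_3^{(1)}(z)= \frac{1}{8}\sum_{n=1}^\infty \frac{(2\sin z)^{2n}}{n^3\binom{2n}{n}} = \frac{z}{2}\operatorname{Im}\operatorname{Li}_2(1-e^{-2iz})-\frac12\operatorname{Re}\operatorname{Li}_3(1-e^{-2iz}),$$ $$\operatorname{ls}_4^{(1)}(z)= -\frac{1}{8}\sum_{n=1}^\infty \frac{(2\sin z)^{2n}}{n^4\binom{2n}{n}} = -\frac{z^4}{4}+\operatorname{Re}\operatorname{Li}_4(1-e^{-2iz})-z\operatorname{Im}\operatorname{Li}_3(1-e^{-2iz}),$$ $$\begin{aligned}\operatorname{ls}_5^{(1)}(z)= \frac{3}{16}\sum_{n=1}^\infty \frac{(2\sin z)^{2n}}{n^5\binom{2n}{n}} &=\frac{3z^4}{4}\log(2\sin z)+\frac{3}{8}\zeta(5)+\frac{3z^2}{4}\zeta(3)\\&\quad+\frac{3z}{4}\left(\operatorname{Im}\operatorname{Li}_4(e^{-2iz})+4\operatorname{Im}\operatorname{Li}_4(1-e^{-2iz})\right)\\&\quad-\frac{3}{8}\left(\operatorname{Re}\operatorname{Li}_5(e^{-2iz})+8\operatorname{Re}\operatorname{Li}_5(1-e^{-2iz})\right).\end{aligned}$$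
   Context: For integers $0\le k<m$ and $0<z\le\frac{\pi}{2}$, the normalized log-sine integral is $$\operatorname{ls}_m^{(k)}(z)= -\int_0^z t^k\left(\log\frac{\sin t}{\sin z}\right)^{m-1-k}dt.$$ $\zeta$ is the Riemann zeta function. $\operatorname{Li}_m(x)=\sum_{n\ge1}x^n n^{-m}$ for $|x|<1$ is the polylogarithm, extended by analytic continuation to $\mathbb{C}\setminus[1,\infty)$ (principal branch). *)

(* Defs.v *)
From Stdlib Require Export Reals ClassicalEpsilon.
From Coquelicot Require Export Coquelicot.

(* After these imports [C] is the type of complex numbers; the real binomial
   coefficient of the standard library is [Binomial.C]. *)

Open Scope R_scope.

(* The integral is improper at 0, where the logarithm is unbounded. *)
Definition ls (m k : nat) (z : R) : R :=
  - RInt_gen (fun t => t ^ k * ln (sin t / sin z) ^ (m - 1 - k))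
      (at_right 0) (at_point z).

(* Meaningful for real s > 1 only. *)
Definition zeta (s : R) : R := Series (fun n => / Rpower (INR (S n)) s).

Definition Cexp (w : C) : C := (exp (Re w) * cos (Im w), exp (Re w) * sin (Im w)).

Definition slit_plane (x : C) : Prop := ~ (1 <= Re x /\ Im x = 0).

Definition analytic_at (f : C -> C) (a : C) : Prop :=
  exists (r : R) (c : nat -> C), 0 < r /\
    forall w : C, Cmod (w - a) < r ->
      is_series (V := C_NormedModule) (fun n => c n * (w - a) ^ n)%C (f w).

Definition is_polylog (m : nat) (f : C -> C) : Prop :=
  (forall x : C, slit_plane x -> analytic_at f x) /\
  (forall x : C, Cmod x < 1 ->
     is_series (V := C_NormedModule)
       (fun n => x ^ (S n) / RtoC (INR (S n) ^ m))%C (f x)).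

(* The slit plane is connected, so [is_polylog m] determines a function on it
   uniquely; on the cut [1, +oo) the values of [Li m] are arbitrary. *)
Definition Li (m : nat) : C -> C :=
  epsilon (inhabits (fun _ : C => RtoC 0)) (is_polylog m).

(* The [n]-th term here is the term of index [n + 1] of the series over n >= 1. *)
Definition central_binomial_term (p : nat) (z : R) (n : nat) : R :=
  (2 * sin z) ^ (2 * S n) / (INR (S n) ^ p * Binomial.C (2 * S n) (S n)).

(* Main.v *)
Require Import Defs.
From Stdlib Require Import Lra Lia Factorial Classical.

(** Write E = exp(-2iz), W = 1 - E, and T_p(z) for the sum over n >= 1 of
    (2 sin z)^(2n) / (n^p binom(2n,n)).  All three members of each line are
    handled by differentiating in z.

    Series.  T_p is a power series in sin^2 z, and T_p' = 2 cot z T_(p-1).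
    The recurrence of the central binomial coefficients is a first-order
    differential equation for the series with p = 1, whose solution gives the
    classical value T_2 = 2 z^2 ([central_binomial_sum_2]).

    Integrals.  With L = ln (sin t / sin z) one has dL/dt = cot t, so t L^k has
    an explicit antiderivative, a combination of T_2 L^k, T_3 L^(k-1), ...,
    T_(k+2); all its terms vanish as t -> 0 and only the last one survives at
    t = z ([ls_antiderivative] and [ls_3_1], [ls_4_1], [ls_5_1]).

    Polylogarithms.  Along the two curves,
      d/dz Li_(m+1)(W) = (cot z - i) Li_m(W),   Li_1(W) = 2 i z,
      d/dz Li_(m+1)(E) = - 2 i Li_m(E),         Re Li_1(E) = - ln (2 sin z),
    because W'/W = cot z - i and E'/E = - 2 i.  Hence Re Li_2(W) = z^2, and both
    sides of the weight 3 and weight 4 identities have the same derivative and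
    tend to 0 with z.  For weight 5 the derivatives agree thanks to
      2 z ln (2 sin z) = Im Li_2(E) + Im Li_2(W),
      2 z^2 ln (2 sin z) + zeta(3) = Re Li_3(E) + 2 Re Li_3(W),
    proved in the same way.  The constant in the first relation is read off at
    z = pi/6, where W is the conjugate of E and 2 sin z = 1; the other constants
    come from E -> 1, W -> 0.

    Continuation.  To speak of Li_m off the disk, a function analytic on the
    slit plane and summing the defining series is needed.  It is
      x / k! * int_0^1 2 v (-2 ln v)^k / (1 - x v^2) dv,   k = m - 1,
    the usual integral of (-ln u)^k / (1 - x u) after u = v^2; this substitution
    makes the integrand continuous on the closed interval, so proper Riemann
    integrals suffice.  Expanding 1/(1 - x v^2) around 1/(1 - a v^2) as a finite
    geometric sum with exact remainder gives the local power series at a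
    ([polylog_int_analytic]), the defining series on the closed unit disk minus
    {1} ([polylog_series]) and the derivative ([polylog_derive]).  The identity
    theorem along the segment from 0 to x shows that every continuation agrees
    with this one ([Li_eq_polylog]). *)

(** * Complex-valued functions of a real variable *)

Definition C_continuous (f : R -> C) (x : R) : Prop :=
  continuous (fun t => Re (f t)) x /\ continuous (fun t => Im (f t)) x.

Definition is_C_derive (f : R -> C) (x : R) (l : C) : Prop :=
  is_derive (fun t => Re (f t)) x (Re l) /\ is_derive (fun t => Im (f t)) x (Im l).

Definition is_CInt (f : R -> C) (l : C) : Prop :=
  is_RInt (fun t => Re (f t)) 0 1 (Re l) /\ is_RInt (fun t => Im (f t)) 0 1 (Im l).

Definition CInt (f : R -> C) : C :=
  (RInt (fun t => Re (f t)) 0 1, RInt (fun t => Im (f t)) 0 1).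

Lemma is_CInt_unique f l : is_CInt f l -> CInt f = l.
Proof.
  intros [H1 H2]; unfold CInt.
  rewrite (is_RInt_unique _ _ _ _ H1), (is_RInt_unique _ _ _ _ H2).
  now destruct l.
Qed.

Lemma CInt_correct f :
  (forall t, 0 <= t <= 1 -> C_continuous f t) -> is_CInt f (CInt f).
Proof.
  intros H; split; apply (@RInt_correct R_CompleteNormedModule);
    apply (@ex_RInt_continuous R_CompleteNormedModule);
    rewrite Rmin_left, Rmax_right by lra; intros t Ht; apply (H t Ht).
Qed.

Lemma is_CInt_ext f g l :
  (forall t, 0 < t < 1 -> f t = g t) -> is_CInt f l -> is_CInt g l.
Proof.
  intros E [H1 H2]; split; (eapply is_RInt_ext; [|eassumption]);
    rewrite Rmin_left, Rmax_right by lra; intros t Ht; simpl; now rewrite E.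
Qed.

Lemma is_CInt_plus f g lf lg :
  is_CInt f lf -> is_CInt g lg -> is_CInt (fun t => f t + g t)%C (lf + lg)%C.
Proof.
  intros [H1 H2] [H3 H4]; split; [exact (is_RInt_plus _ _ _ _ _ _ H1 H3)
                                 | exact (is_RInt_plus _ _ _ _ _ _ H2 H4)].
Qed.

Lemma is_CInt_scal (c : C) f l :
  is_CInt f l -> is_CInt (fun t => c * f t)%C (c * l)%C.
Proof.
  intros [H1 H2]; split.
  - exact (is_RInt_minus _ _ _ _ _ _ (is_RInt_scal _ _ _ (fst c) _ H1)
                                    (is_RInt_scal _ _ _ (snd c) _ H2)).
  - exact (is_RInt_plus _ _ _ _ _ _ (is_RInt_scal _ _ _ (fst c) _ H2)
                                    (is_RInt_scal _ _ _ (snd c) _ H1)).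
Qed.

Lemma is_CInt_minus f g lf lg :
  is_CInt f lf -> is_CInt g lg -> is_CInt (fun t => f t - g t)%C (lf - lg)%C.
Proof.
  intros [H1 H2] [H3 H4]; split; [exact (is_RInt_minus _ _ _ _ _ _ H1 H3)
                                 | exact (is_RInt_minus _ _ _ _ _ _ H2 H4)].
Qed.

Lemma is_CInt_zero : is_CInt (fun _ => 0%C) 0%C.
Proof.
  assert (H : is_RInt (fun _ => 0) 0 1 0).
  { evar_last. apply is_RInt_const. cbv [scal mult]; simpl. unfold mult; simpl; ring. }
  now split.
Qed.

Lemma Cmod_le_Re_Im (w : C) : Cmod w <= Rabs (Re w) + Rabs (Im w).
Proof.
  pose proof (Rabs_pos (Re w)); pose proof (Rabs_pos (Im w)).
  unfold Cmod. apply Rsqr_incr_0_var; [|lra].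
  rewrite Rsqr_sqrt by nra. unfold Rsqr.
  rewrite <- (pow2_abs (fst w)), <- (pow2_abs (snd w)). unfold Re, Im in *. nra.
Qed.

Lemma im_le_Cmod (w : C) : Rabs (Im w) <= Cmod w.
Proof. eapply Rle_trans; [|apply Rmax_Cmod]. apply Rmax_r. Qed.

(** The factor 2 comes from bounding the real and imaginary parts separately,
    which is enough for every limit argument below. *)
Lemma is_CInt_bound f g l I :
  (forall t, 0 <= t <= 1 -> Cmod (f t) <= g t) ->
  is_CInt f l -> is_RInt g 0 1 I -> Cmod l <= 2 * I.
Proof.
  intros B [H1 H2] Hg.
  assert (A1 : Rabs (Re l) <= I).
  { refine (norm_RInt_le _ _ 0 1 _ _ Rle_0_1 _ H1 Hg). intros t Ht.
    eapply Rle_trans; [|apply (B t Ht)]. apply re_le_Cmod. }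
  assert (A2 : Rabs (Im l) <= I).
  { refine (norm_RInt_le _ _ 0 1 _ _ Rle_0_1 _ H2 Hg). intros t Ht.
    eapply Rle_trans; [|apply (B t Ht)]. apply im_le_Cmod. }
  pose proof (Cmod_le_Re_Im l). lra.
Qed.

Lemma C_continuous_const (c : C) x : C_continuous (fun _ => c) x.
Proof. split; apply continuous_const. Qed.

Lemma C_continuous_RtoC (f : R -> R) (x : R) : continuous f x -> C_continuous (fun t => RtoC (f t)) x.
Proof. intros H; split; [exact H|apply continuous_const]. Qed.

Lemma C_continuous_minus f g x :
  C_continuous f x -> C_continuous g x -> C_continuous (fun t => f t - g t)%C x.
Proof.
  intros [H1 H2] [H3 H4]; split; [exact (continuous_minus _ _ _ H1 H3)
                                 | exact (continuous_minus _ _ _ H2 H4)].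
Qed.

Lemma C_continuous_mult f g x :
  C_continuous f x -> C_continuous g x -> C_continuous (fun t => f t * g t)%C x.
Proof.
  intros [H1 H2] [H3 H4]; split.
  - exact (continuous_minus _ _ _ (continuous_mult _ _ _ H1 H3) (continuous_mult _ _ _ H2 H4)).
  - exact (continuous_plus _ _ _ (continuous_mult _ _ _ H1 H4) (continuous_mult _ _ _ H2 H3)).
Qed.

Lemma C_continuous_pow f n x :
  C_continuous f x -> C_continuous (fun t => f t ^ n)%C x.
Proof.
  intros H; induction n as [|n IH]; [apply C_continuous_const|].
  apply (C_continuous_mult f _ _ H IH).
Qed.

Lemma Csqr_norm_neq0 (w : C) : w <> 0%C -> fst w ^ 2 + snd w ^ 2 <> 0.
Proof.
  intros Hw E. apply Hw. destruct w as [a b]; simpl in *.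
  assert (a = 0) by nra. assert (b = 0) by nra. now subst.
Qed.

Lemma C_continuous_inv f x :
  C_continuous f x -> f x <> 0%C -> C_continuous (fun t => / f t)%C x.
Proof.
  intros [H1 H2] Hx. apply Csqr_norm_neq0 in Hx.
  assert (D : continuous (fun t => / (fst (f t) ^ 2 + snd (f t) ^ 2)) x).
  { apply (continuous_comp (fun t => fst (f t) ^ 2 + snd (f t) ^ 2) Rinv).
    - apply (continuous_ext (fun t => plus (mult (Re (f t)) (Re (f t))) (mult (Im (f t)) (Im (f t))))).
      + intros t; unfold plus, mult; simpl. unfold Re, Im; ring.
      + apply (continuous_plus (V := R_NormedModule)); now apply (continuous_mult (K := R_AbsRing)).
    - apply continuity_pt_filterlim. apply (continuity_pt_inv id).
      apply continuity_pt_id. exact Hx. }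
  split.
  - exact (continuous_mult _ _ _ H1 D).
  - exact (continuous_mult _ _ _ (continuous_opp _ _ H2) D).
Qed.

Lemma is_C_derive_continuous f x l : is_C_derive f x l -> C_continuous f x.
Proof.
  intros [H1 H2]; split; apply (ex_derive_continuous (V := R_NormedModule)); eexists; eassumption.
Qed.

Lemma is_C_derive_eq f x l l' : is_C_derive f x l -> l = l' -> is_C_derive f x l'.
Proof. now intros H <-. Qed.

Lemma is_C_derive_const (c : C) x : is_C_derive (fun _ => c) x 0%C.
Proof.
  split; [exact (is_derive_const (V := R_NormedModule) (Re c) x)
         |exact (is_derive_const (V := R_NormedModule) (Im c) x)].
Qed.

Lemma is_C_derive_RtoC (f : R -> R) (x l : R) :
  is_derive f x l -> is_C_derive (fun t => RtoC (f t)) x (RtoC l).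
Proof.
  intros H; split; [exact H|].
  exact (is_derive_const (V := R_NormedModule) 0 x).
Qed.

Lemma is_C_derive_minus f g x lf lg :
  is_C_derive f x lf -> is_C_derive g x lg ->
  is_C_derive (fun t => f t - g t)%C x (lf - lg)%C.
Proof.
  intros [H1 H2] [H3 H4]; split; [exact (is_derive_minus _ _ _ _ _ H1 H3)
                                 | exact (is_derive_minus _ _ _ _ _ H2 H4)].
Qed.

Lemma is_C_derive_mult f g x lf lg :
  is_C_derive f x lf -> is_C_derive g x lg ->
  is_C_derive (fun t => f t * g t)%C x (lf * g x + f x * lg)%C.
Proof.
  intros [H1 H2] [H3 H4]; split.
  - evar_last.
    + exact (is_derive_minus _ _ _ _ _ (is_derive_mult _ _ _ _ _ H1 H3 Rmult_comm)
                                    (is_derive_mult _ _ _ _ _ H2 H4 Rmult_comm)).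
    + unfold minus, plus, opp, mult, Re, Im; simpl. ring.
  - evar_last.
    + exact (is_derive_plus _ _ _ _ _ (is_derive_mult _ _ _ _ _ H1 H4 Rmult_comm)
                                    (is_derive_mult _ _ _ _ _ H2 H3 Rmult_comm)).
    + unfold minus, plus, opp, mult, Re, Im; simpl. ring.
Qed.

Lemma is_C_derive_inv f x l :
  is_C_derive f x l -> f x <> 0%C ->
  is_C_derive (fun t => / f t)%C x (- l / (f x * f x))%C.
Proof.
  intros [H1 H2] Hx. pose proof (Csqr_norm_neq0 _ Hx) as Hn.
  assert (S1 : is_derive (fun t => fst (f t) ^ 2 + snd (f t) ^ 2) x
             (2 * fst (f x) * Re l + 2 * snd (f x) * Im l)).
  { evar_last.
    - apply (is_derive_plus (V := R_NormedModule)).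
      + apply (is_derive_pow _ 2 _ _ H1).
      + apply (is_derive_pow _ 2 _ _ H2).
    - unfold plus; simpl. unfold Re, Im; ring. }
  assert (E : (- l / (f x * f x))%C =
    let a := fst (f x) in let b := snd (f x) in let N := a ^ 2 + b ^ 2 in
    ((Re l * N - a * (2 * a * Re l + 2 * b * Im l)) / N ^ 2,
     ((- Im l) * N - (- b) * (2 * a * Re l + 2 * b * Im l)) / N ^ 2)).
  { unfold Cdiv. destruct (f x) as [a b], l as [c d]; simpl in *.
    unfold Cinv, Cmult, Copp, Re, Im; simpl.
    apply f_equal2; field; (split; [nra|]); intros Z; apply (pow_nonzero _ 2 Hn);
      rewrite <- Z; ring. }
  rewrite E; simpl; split.
  - exact (is_derive_div _ _ _ _ _ H1 S1 Hn).
  - exact (is_derive_div _ _ _ _ _ (is_derive_opp _ _ _ H2) S1 Hn).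
Qed.

(** * Powers of the logarithm as weights on the unit interval *)

(** With y = - ln v and K = 2 (k + 1), the inequality y / K <= exp (y / K) gives
    y^k <= K^k exp (y / 2) = K^k / sqrt v. *)
Lemma id_ln_pow_bound (k : nat) :
  exists M, 0 < M /\ forall v, 0 < v <= 1 -> v * Rabs (ln v) ^ k <= M * sqrt v.
Proof.
  set (K := 2 * (INR k + 1)).
  assert (HK : 0 < K) by (unfold K; pose proof (pos_INR k); lra).
  exists (K ^ k); split; [now apply pow_lt|]. intros v [Hv Hv1].
  assert (Hy : ln v <= 0).
  { rewrite <- ln_1. destruct (Req_dec v 1) as [->|]; [lra|]. left; apply ln_increasing; lra. }
  rewrite Rabs_left1 by exact Hy. set (y := - ln v). assert (0 <= y) by (unfold y; lra).
  assert (Ey : y <= K * exp (y / K)).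
  { pose proof (exp_ineq1_le (y / K)).
    apply Rle_trans with (K * (1 + y / K)).
    - replace (K * (1 + y / K)) with (K + y) by (field; lra). lra.
    - apply Rmult_le_compat_l; lra. }
  assert (Ev : v = sqrt v * sqrt v) by (rewrite sqrt_sqrt; lra).
  assert (Es : sqrt v = exp (- (y / 2))).
  { apply sqrt_lem_1; [lra|left; apply exp_pos|].
    rewrite <- exp_plus. replace (- (y / 2) + - (y / 2)) with (ln v) by (unfold y; field).
    now apply exp_ln. }
  assert (Ek : y ^ k <= K ^ k * exp (y / 2)).
  { apply Rle_trans with ((K * exp (y / K)) ^ k); [apply pow_incr; lra|].
    rewrite Rpow_mult_distr. apply Rmult_le_compat_l; [apply pow_le; lra|].
    rewrite <- (Rpower_pow k (exp (y / K))) by apply exp_pos.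
    unfold Rpower. rewrite ln_exp.
    assert (INR k * (y / K) <= y / 2).
    { unfold K. pose proof (pos_INR k). apply Rmult_le_reg_r with (2 * (INR k + 1)); [lra|].
      replace (INR k * (y / (2 * (INR k + 1))) * (2 * (INR k + 1))) with (INR k * y) by (field; lra).
      nra. }
    destruct (Req_dec (INR k * (y / K)) (y / 2)) as [->|]; [lra|].
    left; apply exp_increasing; lra. }
  assert (P : sqrt v * exp (y / 2) = 1).
  { rewrite Es, <- exp_plus. replace (- (y / 2) + y / 2) with 0 by ring. apply exp_0. }
  rewrite Ev at 1. pose proof (sqrt_pos v).
  apply Rle_trans with (sqrt v * sqrt v * (K ^ k * exp (y / 2))).
  - apply Rmult_le_compat_l; [nra|exact Ek].
  - replace (sqrt v * sqrt v * (K ^ k * exp (y / 2))) with (K ^ k * sqrt v * (sqrt v * exp (y / 2))) by ring.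
    rewrite P; lra.
Qed.

(** The density (-ln u)^k / k! du on the unit interval after u = v^2; its moments
    against v^(2n) are the coefficients 1 / (n+1)^(k+1) of the polylogarithm. *)
Definition log_weight (k : nat) (v : R) : R := 2 * v * (- 2 * ln v) ^ k / INR (fact k).

Lemma ln_nonpos (v : R) : v <= 0 -> ln v = 0.
Proof. intros H; unfold ln. destruct (Rlt_dec 0 v); [exfalso; lra|reflexivity]. Qed.

Lemma ln_le_0 (v : R) : v <= 1 -> ln v <= 0.
Proof.
  intros H. destruct (Rle_dec v 0); [rewrite ln_nonpos by exact r; lra|].
  destruct (Req_dec v 1) as [->|]; [rewrite ln_1; lra|].
  rewrite <- ln_1; left; apply ln_increasing; lra.
Qed.

Lemma log_weight_0 k : log_weight k 0 = 0.
Proof. unfold log_weight. field. apply INR_fact_neq_0. Qed.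

Lemma log_weight_ge0 k v : 0 <= v <= 1 -> 0 <= log_weight k v.
Proof.
  intros H. unfold log_weight. pose proof (ln_le_0 v (proj2 H)).
  apply Rmult_le_pos; [|left; apply Rinv_0_lt_compat, INR_fact_lt_0].
  apply Rmult_le_pos; [lra|apply pow_le; lra].
Qed.

Lemma continuous_sqrt_Rabs_0 : continuous (fun v => sqrt (Rabs v)) 0.
Proof.
  apply (continuous_comp Rabs sqrt).
  - apply continuity_pt_filterlim, Rcontinuity_abs.
  - rewrite Rabs_R0. apply continuous_sqrt.
Qed.

Lemma continuous_squeeze_0 (f g : R -> R) :
  f 0 = 0 -> g 0 = 0 -> continuous g 0 ->
  locally 0 (fun v => Rabs (f v) <= g v) -> continuous f 0.
Proof.
  intros F0 G0 Cg B. unfold continuous. rewrite F0.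
  apply (filterlim_locally (F := locally 0) f 0). intros eps.
  generalize (proj1 (filterlim_locally (F := locally 0) g (g 0)) Cg eps). rewrite G0.
  intros Hg. generalize (filter_and _ _ B Hg). apply filter_imp.
  intros v [H1 H2]. change (Rabs (g v - 0) < eps) in H2. change (Rabs (f v - 0) < eps).
  rewrite Rminus_0_r in *. eapply Rle_lt_trans; [exact H1|].
  eapply Rle_lt_trans; [apply Rle_abs|exact H2].
Qed.

Lemma continuous_Rabs x : continuous Rabs x.
Proof. apply continuity_pt_filterlim, Rcontinuity_abs. Qed.

(** The endpoint 0 is included: [ln] vanishes on the negative half-line, so the
    weight tends to 0 from both sides and ordinary continuity holds there. *)
Lemma log_weight_continuous k v : 0 <= v -> continuous (log_weight k) v.
Proof.
  intros [Hv|<-].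
  - apply (ex_derive_continuous (V := R_NormedModule)). unfold log_weight. auto_derive.
    repeat split; try assumption; apply INR_fact_neq_0.
  - destruct (id_ln_pow_bound k) as [M [HM B]].
    set (D := 2 * 2 ^ k / INR (fact k)).
    assert (HD : 0 < D).
    { unfold D. apply Rdiv_lt_0_compat; [|apply INR_fact_lt_0].
      pose proof (pow_lt 2 k ltac:(lra)); lra. }
    apply (continuous_squeeze_0 _ (fun v => D * M * sqrt (Rabs v) + D * Rabs v)).
    + apply log_weight_0.
    + rewrite Rabs_R0, sqrt_0; ring.
    + apply (continuous_plus (V := R_NormedModule)).
      * apply (continuous_mult (K := R_AbsRing)); [apply continuous_const|].
        apply continuous_sqrt_Rabs_0.
      * apply (continuous_mult (K := R_AbsRing)); [apply continuous_const|apply continuous_Rabs].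
    + exists (mkposreal 1 Rlt_0_1). intros v Hv. change (Rabs (v - 0) < 1) in Hv.
      rewrite Rminus_0_r in Hv.
      assert (E : Rabs (log_weight k v) = D * (Rabs v * Rabs (ln v) ^ k)).
      { unfold log_weight, D, Rdiv. rewrite !Rabs_mult, <- RPow_abs, !Rabs_mult.
        rewrite (Rabs_left (-2)), (Rabs_right 2) by lra. rewrite Rabs_inv, (Rabs_right (INR _)).
        2: left; apply INR_fact_lt_0.
        replace (- -2) with 2 by ring. rewrite Rpow_mult_distr. ring. }
      rewrite E. pose proof (sqrt_pos (Rabs v)). pose proof (Rabs_pos v).
      destruct (Rle_dec v 0) as [N|P].
      * rewrite (ln_nonpos v N), Rabs_R0.
        assert (0 ^ k <= 1) by (destruct k; simpl; lra).
        assert (0 <= D * M * sqrt (Rabs v)) by (apply Rmult_le_pos; nra).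
        assert (D * (Rabs v * 0 ^ k) <= D * Rabs v); [|lra].
        apply Rmult_le_compat_l; nra.
      * rewrite (Rabs_right v) in * by lra.
        specialize (B v ltac:(lra)).
        assert (D * (v * Rabs (ln v) ^ k) <= D * (M * sqrt v)) by (apply Rmult_le_compat_l; lra).
        nra.
Qed.

Lemma is_derive_id_mul_0 (w : R -> R) :
  continuous w 0 -> is_derive (fun v => v * w v) 0 (w 0).
Proof.
  intros Hw. apply is_derive_Reals. intros eps Heps.
  destruct (proj1 (filterlim_locally (F := locally 0) w (w 0)) Hw (mkposreal eps Heps)) as [d Hd].
  exists d. intros h Hh Hhd.
  replace ((0 + h) * w (0 + h) - 0 * w 0) with (h * w h) by (rewrite Rplus_0_l; ring).
  replace (h * w h / h) with (w h) by (field; exact Hh).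
  apply (Hd h). change (Rabs (h - 0) < d). now rewrite Rminus_0_r.
Qed.

(** The integrand is the derivative of v * log_weight (S k) v / 2 * g v, a function
    that vanishes at 0 because of the factor v and at 1 because of ln 1 = 0. *)
Lemma log_weight_by_parts k (g g' : R -> R) :
  (forall v, 0 <= v <= 1 -> is_derive g v (g' v)) ->
  (forall v, 0 <= v <= 1 -> continuous g' v) ->
  is_RInt (fun v => log_weight (S k) v * (g v + v * g' v / 2) - log_weight k v * g v) 0 1 0.
Proof.
  intros Dg Cg.
  assert (Cgg : forall v, 0 <= v <= 1 -> continuous g v).
  { intros v Hv. apply (ex_derive_continuous (V := R_NormedModule)). eexists; eauto. }
  (* The factor v is kept in front so that the derivative at 0 comes from
     [is_derive_id_mul_0]. *)
  set (W := fun v => v * (log_weight (S k) v / 2)).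
  assert (CW : forall v, 0 <= v -> continuous (fun v => log_weight (S k) v / 2) v).
  { intros v Hv. apply (continuous_mult (K := R_AbsRing) _ (fun _ => / 2)); [|apply continuous_const].
    now apply log_weight_continuous. }
  assert (DW : forall v, 0 <= v -> is_derive W v (log_weight (S k) v - log_weight k v)).
  { intros v [Hv|<-].
    - assert (Ef : INR (fact (S k)) = (INR k + 1) * INR (fact k)).
      { rewrite fact_simpl, mult_INR, S_INR; ring. }
      pose proof (INR_fact_neq_0 k). pose proof (pos_INR k).
      unfold W, log_weight. rewrite Ef. auto_derive; [exact Hv|].
      change (match k with 0%nat => 1 | S _ => INR k + 1 end) with (INR (S k)).
      rewrite S_INR. simpl pow. field. repeat split; lra.
    - rewrite !log_weight_0. evar_last.
      + apply (is_derive_id_mul_0 (fun v => log_weight (S k) v / 2)). apply CW; lra.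
      + simpl. rewrite log_weight_0; field. }
  assert (I : is_RInt (fun v => (log_weight (S k) v - log_weight k v) * g v + W v * g' v) 0 1
                (minus (W 1 * g 1) (W 0 * g 0))).
  { apply (is_RInt_derive (V := R_CompleteNormedModule) (fun v => W v * g v));
    rewrite Rmin_left, Rmax_right by lra; intros v Hv.
    - apply (is_derive_mult (K := R_AbsRing) W g); [apply DW; lra|apply Dg, Hv|intros; apply Rmult_comm].
    - apply (continuous_plus (V := R_NormedModule)); apply (continuous_mult (K := R_AbsRing)); auto.
      + apply (continuous_minus (V := R_NormedModule)); apply log_weight_continuous; lra.
      + apply (ex_derive_continuous (V := R_NormedModule)); eexists; apply DW; lra. }
  replace (minus (W 1 * g 1) (W 0 * g 0)) with 0 in I.
  - eapply is_RInt_ext; [|exact I]. intros v _. unfold W; simpl; field.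
  - unfold minus, plus, opp, W; simpl. unfold log_weight at 1. rewrite ln_1. simpl.
    unfold Rdiv; ring.
Qed.

(** Induction on k: integrating by parts against v^(2n) divides by n + 1. *)
Lemma log_weight_moment k n :
  is_RInt (fun v => log_weight k v * v ^ (2 * n)) 0 1 (/ INR (S n) ^ S k).
Proof.
  assert (HS : INR (S n) <> 0) by (apply not_0_INR; lia).
  induction k as [|k IH].
  - evar_last.
    + eapply is_RInt_ext.
      2: apply (is_RInt_derive (V := R_CompleteNormedModule) (fun v => v ^ (2 * n + 2) / INR (S n))
                 (fun v => 2 * v * v ^ (2 * n))).
      * intros v _. unfold log_weight. simpl. field.
      * intros v _. auto_derive; [exact I|].
        change (match n with 0%nat => 1 | S _ => INR n + 1 end) with (INR (S n)).
        change (n + (n + 0))%nat with (2 * n)%nat.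
        replace (pred (2 * n + 2)) with (S (2 * n)) by lia.
        rewrite plus_INR, mult_INR. change (INR 2) with 2.
        rewrite (S_INR n) in *. rewrite <- tech_pow_Rmult. field. exact HS.
      * intros v _. apply (ex_derive_continuous (V := R_NormedModule)); auto_derive; exact I.
    + unfold minus, plus, opp; simpl. rewrite pow1, pow_i by lia. simpl. field. exact HS.
  - pose proof (log_weight_by_parts k (fun v => v ^ (2 * n))
      (fun v => INR (2 * n) * v ^ pred (2 * n))) as H.
    assert (H' : is_RInt (fun v => log_weight (S k) v * (INR (S n) * v ^ (2 * n))
        - log_weight k v * v ^ (2 * n)) 0 1 0).
    { eapply is_RInt_ext; [|apply H].
      - intros v _. cbv beta. f_equal. f_equal.
        rewrite S_INR, mult_INR. destruct n as [|n]; [simpl; field|].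
        rewrite (Nat.mul_succ_r 2 n). replace (2 * n + 2)%nat with (S (S (2 * n))) by lia.
        simpl pow. simpl pred. simpl pow. simpl (INR 2). field.
      - intros v _. evar_last. apply (is_derive_pow (fun v => v) (2 * n) v 1), (is_derive_id (K := R_AbsRing)).
        simpl; ring.
      - intros v _. apply (ex_derive_continuous (V := R_NormedModule)); auto_derive; exact I. }
    pose proof (is_RInt_scal _ _ _ (/ INR (S n)) _ (is_RInt_plus _ _ _ _ _ _ H' IH)) as Q.
    set (c := INR (S n)) in *. clearbody c.
    evar_last; [eapply is_RInt_ext; [|exact Q]|].
    + intros v _. unfold scal, plus; simpl; unfold mult; simpl. field. exact HS.
    + unfold scal, plus; simpl; unfold mult; simpl. rewrite Rplus_0_l. field.
      split; [now apply pow_nonzero|exact HS].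
Qed.

(** * Polylogarithms as integrals over the unit interval *)

Definition cut_factor (a : C) (v : R) : C := (1 - a * RtoC (v ^ 2))%C.

(** The factor stays away from 0 for all v in the unit interval exactly when a is
    off the cut [1, +oo); the uniform bound d also serves as a radius of
    convergence at a. *)
Definition off_cut (a : C) (d : R) : Prop :=
  0 < d /\ forall v, 0 <= v <= 1 -> d <= Cmod (cut_factor a v).

(** |1 - a v^2|^2 is a continuous positive function of v on a compact interval. *)
Lemma slit_plane_off_cut a : slit_plane a -> exists d, off_cut a d.
Proof.
  intros Ha.
  set (p := fun v => (1 - Re a * v ^ 2) ^ 2 + (Im a * v ^ 2) ^ 2).
  assert (Cp : forall v, 0 <= v <= 1 -> continuity_pt p v).
  { intros v _. apply continuity_pt_filterlim.
    apply (ex_derive_continuous (V := R_NormedModule)). unfold p; auto_derive; exact I. }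
  destruct (continuity_ab_min p 0 1 Rle_0_1 Cp) as [m [Hm Hm01]].
  assert (Pm : 0 < p m).
  { assert (0 <= p m) by (unfold p; apply Rplus_le_le_0_compat; apply pow2_ge_0).
    destruct (Req_dec (p m) 0) as [E|]; [exfalso|lra].
    unfold p in E. rewrite <- !Rsqr_pow2 in E. destruct (Rplus_sqr_eq_0 _ _ E) as [E1 E2].
    rewrite Rsqr_pow2 in E1, E2.
    assert (m <> 0) by (intros ->; lra). apply Ha. split.
    - assert (0 < m ^ 2 <= 1) by nra. nra.
    - apply Rmult_integral in E2 as [|E2]; [assumption|]. exfalso. now apply (pow_nonzero m 2). }
  exists (sqrt (p m)); split; [now apply sqrt_lt_R0|].
  intros v Hv. unfold Cmod. apply sqrt_le_1_alt.
  replace (fst (cut_factor a v) ^ 2 + snd (cut_factor a v) ^ 2) with (p v); [now apply Hm|].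
  unfold p, cut_factor, Re, Im; simpl. ring.
Qed.

Lemma off_cut_neq0 a d v : off_cut a d -> 0 <= v <= 1 -> cut_factor a v <> 0%C.
Proof.
  intros [Hd H] Hv E. specialize (H v Hv). rewrite E, Cmod_0 in H. lra.
Qed.

Lemma Cmod_RtoC_nonneg r : 0 <= r -> Cmod (RtoC r) = r.
Proof. intros H; rewrite Cmod_R; now apply Rabs_pos_eq. Qed.

Lemma cut_factor_shift a x v :
  cut_factor x v = (cut_factor a v - RtoC (v ^ 2) * (x - a))%C.
Proof. unfold cut_factor; ring. Qed.

Lemma off_cut_near a d x :
  off_cut a d -> Cmod (x - a) < d -> off_cut x (d - Cmod (x - a)).
Proof.
  intros [Hd H] Hx; split; [lra|]. intros v Hv. specialize (H v Hv).
  rewrite (cut_factor_shift a x v).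
  assert (T : Cmod (cut_factor a v) <=
    Cmod (cut_factor a v - RtoC (v ^ 2) * (x - a)) + Cmod (RtoC (v ^ 2) * (x - a))).
  { eapply Rle_trans; [|apply Cmod_triangle]. right; f_equal; ring. }
  rewrite (Cmod_mult (RtoC _)), (Cmod_RtoC_nonneg (v ^ 2)) in T by apply pow2_ge_0.
  assert (v ^ 2 <= 1) by nra. pose proof (Cmod_ge_0 (x - a)). nra.
Qed.

Definition weighted_int (k : nat) (f : R -> C) : C :=
  CInt (fun v => RtoC (log_weight k v) * f v)%C.

Lemma is_CInt_weighted k f :
  (forall v, 0 <= v <= 1 -> C_continuous f v) ->
  is_CInt (fun v => RtoC (log_weight k v) * f v)%C (weighted_int k f).
Proof.
  intros H. apply CInt_correct. intros v Hv. apply C_continuous_mult; [|auto].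
  apply C_continuous_RtoC, log_weight_continuous, Hv.
Qed.

(** The case n > 0 produces the decay in n that is needed on the unit circle,
    where the geometric ratio gives none. *)
Lemma weighted_int_bound k f B n :
  (forall v, 0 <= v <= 1 -> C_continuous f v) ->
  (forall v, 0 <= v <= 1 -> Cmod (f v) <= B * v ^ (2 * n)) ->
  Cmod (weighted_int k f) <= 2 * B / INR (S n) ^ S k.
Proof.
  intros Cf Bf.
  pose proof (is_RInt_scal _ _ _ B _ (log_weight_moment k n)) as I.
  replace (2 * B / INR (S n) ^ S k) with (2 * (B * / INR (S n) ^ S k)) by (unfold Rdiv; ring).
  refine (is_CInt_bound _ _ _ _ _ (is_CInt_weighted k f Cf) I).
  intros v Hv. rewrite Cmod_mult, Cmod_RtoC_nonneg by now apply log_weight_ge0.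
  unfold scal; simpl; unfold mult; simpl.
  pose proof (log_weight_ge0 k v Hv). specialize (Bf v Hv). simpl in Bf. nra.
Qed.

Lemma C_continuous_cut_factor a v : C_continuous (cut_factor a) v.
Proof.
  unfold cut_factor. apply C_continuous_minus; [apply C_continuous_const|].
  apply C_continuous_mult; [apply C_continuous_const|].
  apply C_continuous_RtoC, (ex_derive_continuous (V := R_NormedModule)). auto_derive; exact I.
Qed.

Lemma C_continuous_RtoC_pow n v : C_continuous (fun v => RtoC (v ^ n)) v.
Proof.
  apply C_continuous_RtoC, (ex_derive_continuous (V := R_NormedModule)). auto_derive; exact I.
Qed.

Definition polylog_int (k : nat) (x : C) : C :=
  weighted_int k (fun v => / cut_factor x v)%C.

Definition polylog_coef (k : nat) (a : C) (n : nat) : C :=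
  weighted_int k (fun v => RtoC (v ^ (2 * n)) * / cut_factor a v ^ S n)%C.

Lemma C_continuous_inv_cut_factor a d v :
  off_cut a d -> 0 <= v <= 1 -> C_continuous (fun v => / cut_factor a v)%C v.
Proof.
  intros Ha Hv. apply C_continuous_inv; [apply C_continuous_cut_factor|].
  now apply off_cut_neq0 with d.
Qed.

Lemma C_continuous_inv_cut_factor_pow a d n v :
  off_cut a d -> 0 <= v <= 1 -> C_continuous (fun v => / cut_factor a v ^ n)%C v.
Proof.
  intros Ha Hv. apply C_continuous_inv; [apply C_continuous_pow, C_continuous_cut_factor|].
  apply Cpow_nz. now apply off_cut_neq0 with d.
Qed.

(** The ratio q of the geometric series for 1 / (1 - x v^2) centred at a, since
    1 - x v^2 = (1 - a v^2) (1 - q). *)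
Definition taylor_ratio (a x : C) (v : R) : C :=
  (RtoC (v ^ 2) * (x - a) / cut_factor a v)%C.

Lemma C_continuous_taylor_ratio a d x v :
  off_cut a d -> 0 <= v <= 1 -> C_continuous (taylor_ratio a x) v.
Proof.
  intros Ha Hv. unfold taylor_ratio, Cdiv. apply C_continuous_mult.
  - apply C_continuous_mult; [apply C_continuous_RtoC_pow|apply C_continuous_const].
  - now apply C_continuous_inv_cut_factor with d.
Qed.

(** The n-th Taylor term under the integral is (q^n - q^(n+1)) / (1 - x v^2), so
    the partial sums telescope. *)
Lemma polylog_taylor_partial k a d x e N :
  off_cut a d -> off_cut x e ->
  is_CInt (fun v => RtoC (log_weight k v) *
                    ((1 - taylor_ratio a x v ^ S N) / cut_factor x v))%C
    (sum_n (G := C_NormedModule) (fun n => polylog_coef k a n * (x - a) ^ n)%C N).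
Proof.
  intros Ha Hx.
  assert (T : forall n, is_CInt (fun v => (x - a) ^ n * (RtoC (log_weight k v) *
      (RtoC (v ^ (2 * n)) * / cut_factor a v ^ S n)))%C (polylog_coef k a n * (x - a) ^ n)%C).
  { intros n. rewrite Cmult_comm. apply is_CInt_scal, is_CInt_weighted. intros v Hv.
    apply C_continuous_mult; [apply C_continuous_RtoC_pow|].
    now apply C_continuous_inv_cut_factor_pow with d. }
  assert (G : forall n v, 0 < v < 1 ->
    ((x - a) ^ n * (RtoC (log_weight k v) * (RtoC (v ^ (2 * n)) * / cut_factor a v ^ S n)) =
     RtoC (log_weight k v) * ((taylor_ratio a x v ^ n - taylor_ratio a x v ^ S n) / cut_factor x v))%C).
  { intros n v Hv.
    assert (Na : cut_factor a v <> 0%C) by (apply off_cut_neq0 with d; [assumption|lra]).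
    assert (Nx : cut_factor x v <> 0%C) by (apply off_cut_neq0 with e; [assumption|lra]).
    assert (E : cut_factor x v = (cut_factor a v * (1 - taylor_ratio a x v))%C).
    { rewrite (cut_factor_shift a x v). unfold taylor_ratio. field. exact Na. }
    assert (Nq : (1 - taylor_ratio a x v)%C <> 0%C).
    { intros Z. rewrite Z in E. apply Nx. rewrite E. ring. }
    rewrite E, (Cpow_S (taylor_ratio a x v) n).
    replace ((taylor_ratio a x v ^ n - taylor_ratio a x v * taylor_ratio a x v ^ n) /
       (cut_factor a v * (1 - taylor_ratio a x v)))%C
      with (taylor_ratio a x v ^ n / cut_factor a v)%C by (field; split; assumption).
    unfold taylor_ratio, Cdiv. rewrite !Cpow_mult_l, Cpow_inv by exact Na.
    rewrite pow_mult, <- RtoC_pow, Cpow_S. field. split; [exact Na|now apply Cpow_nz]. }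
  induction N as [|N IH].
  - rewrite sum_O. eapply is_CInt_ext; [|apply T]. intros v Hv. cbv beta. rewrite G by exact Hv.
    simpl Cpow. reflexivity.
  - rewrite sum_Sn. eapply is_CInt_ext; [|apply (is_CInt_plus _ _ _ _ IH (T (S N)))].
    intros v Hv. cbv beta. rewrite G by exact Hv. field.
    apply off_cut_neq0 with e; [assumption|lra].
Qed.

Lemma polylog_taylor_remainder k a d x e N :
  off_cut a d -> off_cut x e ->
  (polylog_int k x -
    sum_n (G := C_NormedModule) (fun n => polylog_coef k a n * (x - a) ^ n)%C N)%C =
  weighted_int k (fun v => taylor_ratio a x v ^ S N / cut_factor x v)%C.
Proof.
  intros Ha Hx. symmetry. apply is_CInt_unique.
  eapply is_CInt_ext.
  2: { apply is_CInt_minus; [|apply (polylog_taylor_partial k a d x e N Ha Hx)].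
       apply is_CInt_weighted. intros v Hv. now apply C_continuous_inv_cut_factor with e. }
  intros v Hv. cbv beta. field. apply off_cut_neq0 with e; [assumption|lra].
Qed.

Lemma is_C_series_iff (u : nat -> C) (l : C) :
  is_series (V := C_NormedModule) u l <->
  forall eps, 0 < eps -> exists N0, forall N, (N0 <= N)%nat ->
    Cmod (l - sum_n (G := C_NormedModule) u N) < eps.
Proof.
  split.
  - intros H eps Heps.
    destruct (proj1 (filterlim_locally_ball_norm (F := eventually) (U := C_NormedModule) _ l)
             H (mkposreal eps Heps)) as [N0 H0].
    exists N0. intros N HN. specialize (H0 N HN).
    rewrite <- Cmod_opp, Copp_minus_distr. exact H0.
  - intros H.
    apply (proj2 (filterlim_locally_ball_norm (F := eventually) (U := C_NormedModule) _ l)).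
    intros eps. destruct (H eps (cond_pos eps)) as [N0 H0]. exists N0. intros N HN.
    specialize (H0 N HN). rewrite <- Cmod_opp, Copp_minus_distr in H0. exact H0.
Qed.

Lemma is_lim_seq_eventually_lt (u : nat -> R) eps :
  is_lim_seq u 0 -> 0 < eps -> exists N0, forall N, (N0 <= N)%nat -> u N < eps.
Proof.
  intros H Heps. apply is_lim_seq_spec in H.
  destruct (H (mkposreal eps Heps)) as [N0 H0]. exists N0. intros N HN.
  specialize (H0 N HN). simpl in H0. rewrite Rminus_0_r in H0.
  eapply Rle_lt_trans; [apply Rle_abs|exact H0].
Qed.

Lemma C_series_of_remainder (u : nat -> C) (l : C) (r : nat -> R) :
  (forall N, Cmod (l - sum_n (G := C_NormedModule) u N) <= r N) ->
  is_lim_seq r 0 -> is_series (V := C_NormedModule) u l.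
Proof.
  intros Hr Lr. apply is_C_series_iff. intros eps Heps.
  destruct (is_lim_seq_eventually_lt r eps Lr Heps) as [N0 H0]. exists N0. intros N HN.
  eapply Rle_lt_trans; [apply Hr|now apply H0].
Qed.

Lemma Cmod_taylor_ratio a d x v :
  off_cut a d -> 0 <= v <= 1 -> Cmod (taylor_ratio a x v) <= v ^ 2 * (Cmod (x - a) / d).
Proof.
  intros Ha Hv. pose proof (off_cut_neq0 a d v Ha Hv) as Na. destruct Ha as [Hd Ha].
  unfold taylor_ratio. rewrite Cmod_div by exact Na.
  rewrite Cmod_mult, Cmod_RtoC_nonneg by apply pow2_ge_0.
  unfold Rdiv. rewrite Rmult_assoc. apply Rmult_le_compat_l; [apply pow2_ge_0|].
  apply Rmult_le_compat_l; [apply Cmod_ge_0|]. apply Rinv_le_contravar; auto.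
Qed.

(** The ratio is at most v^2 |x - a| / d, so its power N + 1 carries the factor
    v^(2N+2), whose moment is 1 / (N+2)^(k+1). *)
Lemma polylog_taylor_error k a d x e N :
  off_cut a d -> off_cut x e ->
  Cmod (polylog_int k x -
    sum_n (G := C_NormedModule) (fun n => polylog_coef k a n * (x - a) ^ n)%C N) <=
  2 * ((Cmod (x - a) / d) ^ S N / e) / INR (S (S N)) ^ S k.
Proof.
  intros Ha Hx. rewrite (polylog_taylor_remainder k a d x e N Ha Hx).
  apply weighted_int_bound; intros v Hv.
  - apply C_continuous_mult; [|now apply C_continuous_inv_cut_factor with e].
    apply C_continuous_pow. now apply C_continuous_taylor_ratio with d.
  - pose proof (off_cut_neq0 x e v Hx Hv) as Nx.
    rewrite Cmod_div, Cmod_pow by exact Nx.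
    pose proof (Cmod_taylor_ratio a d x v Ha Hv) as Q. destruct Hx as [He Hx].
    rewrite pow_mult.
    replace ((Cmod (x - a) / d) ^ S N / e * (v ^ 2) ^ S N) with
      ((v ^ 2 * (Cmod (x - a) / d)) ^ S N * / e) by (rewrite Rpow_mult_distr; unfold Rdiv; ring).
    apply Rmult_le_compat; auto.
    + apply pow_le, Cmod_ge_0.
    + left; apply Rinv_0_lt_compat. specialize (Hx v Hv); lra.
    + apply pow_incr; split; [apply Cmod_ge_0|exact Q].
    + apply Rinv_le_contravar; auto.
Qed.

Lemma pow_INR_S_ge_1 n k : 1 <= INR (S n) ^ k.
Proof. apply pow_R1_Rle. rewrite S_INR. pose proof (pos_INR n); lra. Qed.

Lemma polylog_int_analytic k a d x :
  off_cut a d -> Cmod (x - a) < d ->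
  is_series (V := C_NormedModule) (fun n => polylog_coef k a n * (x - a) ^ n)%C (polylog_int k x).
Proof.
  intros Ha Hx. pose proof (off_cut_near a d x Ha Hx) as Hxe.
  set (e := d - Cmod (x - a)) in *. set (q := Cmod (x - a) / d).
  assert (Hd : 0 < d) by apply Ha.
  assert (Hq : 0 <= q < 1).
  { unfold q; split.
    - apply Rdiv_le_0_compat; [apply Cmod_ge_0|exact Hd].
    - apply Rmult_lt_reg_r with d; [exact Hd|]. unfold Rdiv. rewrite Rmult_assoc, Rinv_l; lra. }
  assert (He : 0 < / e) by (apply Rinv_0_lt_compat, Hxe).
  apply C_series_of_remainder with (r := fun N => 2 * / e * (q * q ^ N)).
  - intros N. eapply Rle_trans; [apply (polylog_taylor_error k a d x e N Ha Hxe)|].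
    fold q. pose proof (pow_INR_S_ge_1 (S N) (S k)) as H1.
    assert (0 <= q ^ S N) by (apply pow_le; lra).
    unfold Rdiv at 1. apply Rle_trans with (2 * (q ^ S N / e) * 1); [|simpl; right; unfold Rdiv; ring].
    apply Rmult_le_compat_l; [unfold Rdiv; nra|]. rewrite <- Rinv_1. apply Rinv_le_contravar; lra.
  - evar_last.
    + apply is_lim_seq_mult'; [apply is_lim_seq_const|].
      apply is_lim_seq_mult'; [apply is_lim_seq_const|]. apply is_lim_seq_geom.
      rewrite Rabs_pos_eq; lra.
    + f_equal; ring.
Qed.

Lemma polylog_coef_0 k n : polylog_coef k 0 n = RtoC (/ INR (S n) ^ S k).
Proof.
  apply is_CInt_unique.
  apply (is_CInt_ext (fun v => RtoC (log_weight k v * v ^ (2 * n)))).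
  - intros v _. replace (cut_factor 0 v) with (RtoC 1) by (unfold cut_factor; ring).
    rewrite Cpow_1_l, RtoC_mult. field.
  - split; [apply log_weight_moment|apply is_CInt_zero].
Qed.

Lemma off_cut_0 : off_cut 0 1.
Proof.
  split; [lra|]. intros v _. replace (cut_factor 0 v) with (RtoC 1) by (unfold cut_factor; ring).
  rewrite Cmod_1; lra.
Qed.

(** The factor x shifts the exponents so that the series starts at x^1. *)
Definition polylog (m : nat) (x : C) : C := (x * polylog_int (pred m) x)%C.

Lemma C_series_scal (c : C) (u : nat -> C) (l : C) :
  is_series (V := C_NormedModule) u l -> is_series (V := C_NormedModule) (fun n => c * u n)%C (c * l)%C.
Proof. intros H. exact (is_series_scal (K := C_AbsRing) (V := C_NormedModule) c u l H). Qed.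

(** The factor x is written a + (x - a), which shifts and adds the coefficients
    of the integral. *)
Lemma polylog_analytic m a : slit_plane a -> analytic_at (polylog m) a.
Proof.
  intros Ha. destruct (slit_plane_off_cut a Ha) as [d Hd].
  set (c := polylog_coef (pred m) a).
  exists d, (fun n => a * c n + match n with O => 0 | S p => c p end)%C.
  split; [apply Hd|]. intros w Hw. unfold polylog.
  pose proof (polylog_int_analytic (pred m) a d w Hd Hw) as S1. fold c in S1.
  pose proof (C_series_scal a _ _ S1) as Sa.
  pose proof (C_series_scal (w - a)%C _ _ S1) as Sb.
  replace (w * polylog_int (pred m) w)%C with
    (a * polylog_int (pred m) w + (w - a) * polylog_int (pred m) w)%C by ring.
  assert (Sb' : is_series (V := C_NormedModule)
    (fun n => match n with O => RtoC 0 | S p => ((w - a) * (c p * (w - a) ^ p))%C end)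
    ((w - a) * polylog_int (pred m) w)%C).
  { apply (is_series_decr_1 (V := C_NormedModule)).
    match goal with |- is_series _ ?l =>
      replace l with ((w - a) * polylog_int (pred m) w)%C by (unfold plus, opp; simpl; ring) end.
    exact Sb. }
  eapply is_series_ext; [|exact (is_series_plus (V := C_NormedModule) _ _ _ _ Sa Sb')].
  intros [|n]; unfold plus; simpl; ring.
Qed.

(** On the unit circle the error bound of the Taylor polynomials at 0 still tends
    to 0 thanks to the moments, so boundary points other than 1 are covered. *)
Lemma polylog_series (m : nat) x d :
  (m <> 0)%nat -> off_cut x d -> Cmod x <= 1 ->
  is_series (V := C_NormedModule) (fun n => x ^ (S n) / RtoC (INR (S n) ^ m))%C (polylog m x).
Proof.
  intros Hm Hx H1. destruct m as [|k]; [easy|]. unfold polylog; simpl pred.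
  assert (HS : is_series (V := C_NormedModule)
    (fun n => polylog_coef k 0 n * (x - 0) ^ n)%C (polylog_int k x)).
  { assert (Hd : 0 < / d) by (apply Rinv_0_lt_compat, Hx).
    apply C_series_of_remainder with (r := fun N => 2 * / d * / INR (S (S N))).
    - intros N. eapply Rle_trans; [apply (polylog_taylor_error k 0 1 x d N off_cut_0 Hx)|].
      replace (x - 0)%C with x by ring. rewrite Rdiv_1_r.
      pose proof (pow_INR_S_ge_1 (S N) k) as P. pose proof (pow_INR_S_ge_1 (S N) 1) as P1.
      rewrite pow_1 in P1.
      assert (Q : Cmod x ^ S N <= 1).
      { rewrite <- (pow1 (S N)). apply pow_incr. split; [apply Cmod_ge_0|exact H1]. }
      assert (Q0 : 0 <= Cmod x ^ S N) by apply pow_le, Cmod_ge_0.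
      unfold Rdiv at 1. apply Rmult_le_compat.
      + apply Rmult_le_pos; [lra|]. unfold Rdiv; nra.
      + left; apply Rinv_0_lt_compat, pow_lt; lra.
      + unfold Rdiv; nra.
      + apply Rinv_le_contravar; [lra|]. rewrite <- tech_pow_Rmult. nra.
    - evar_last.
      + apply is_lim_seq_mult'; [apply is_lim_seq_const|].
        apply (proj1 (is_lim_seq_incr_1 (fun n => / INR (S n)) 0)).
        apply (proj1 (is_lim_seq_incr_1 (fun n => / INR n) 0)).
        apply is_lim_seq_inv with (l := p_infty); [apply is_lim_seq_INR|easy].
      + simpl. f_equal; ring. }
  eapply is_series_ext; [|apply (C_series_scal x _ _ HS)].
  intros n. cbv beta. rewrite polylog_coef_0. replace (x - 0)%C with x by ring.
  rewrite RtoC_inv by (apply pow_nonzero, not_0_INR; lia). rewrite Cpow_S. unfold Cdiv.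
  match goal with |- ?a = ?b => change (@eq C a b) end. ring.
Qed.

Lemma Cmod_lt_1_slit x : Cmod x < 1 -> slit_plane x.
Proof.
  intros H [H1 H2]. pose proof (re_le_Cmod x). pose proof (Rle_abs (Re x)). lra.
Qed.

Lemma polylog_is_polylog m : (m <> 0)%nat -> is_polylog m (polylog m).
Proof.
  intros Hm; split; [apply polylog_analytic|]. intros x Hx.
  destruct (slit_plane_off_cut x (Cmod_lt_1_slit x Hx)) as [d Hd].
  apply polylog_series with d; auto. lra.
Qed.

(** * Uniqueness of the analytic continuation *)

Lemma sum_n_Re_Im (u : nat -> C) N :
  Re (sum_n (G := C_NormedModule) u N) = sum_n (fun n => Re (u n)) N /\
  Im (sum_n (G := C_NormedModule) u N) = sum_n (fun n => Im (u n)) N.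
Proof.
  induction N as [|N [IH1 IH2]]; [now rewrite !sum_O|].
  rewrite !sum_Sn, <- IH1, <- IH2. split; reflexivity.
Qed.

Lemma C_series_Re_Im (u : nat -> C) (l : C) :
  is_series (V := C_NormedModule) u l ->
  is_series (fun n => Re (u n)) (Re l) /\ is_series (fun n => Im (u n)) (Im l).
Proof.
  intros H. pose proof (proj1 (is_C_series_iff u l) H) as HC.
  split; apply (proj2 (filterlim_locally_ball_norm (F := eventually) (U := R_NormedModule) _ _));
    intros eps; destruct (HC eps (cond_pos eps)) as [N0 H0]; exists N0; intros N HN;
    specialize (H0 N HN); destruct (sum_n_Re_Im u N) as [E1 E2];
    set (S := sum_n (G := C_NormedModule) u N) in *.
  - change (Rabs (sum_n (fun n => Re (u n)) N - Re l) < eps).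
    rewrite <- E1, Rabs_minus_sym. change (Re l - Re S) with (Re (l - S)%C).
    eapply Rle_lt_trans; [apply re_le_Cmod|exact H0].
  - change (Rabs (sum_n (fun n => Im (u n)) N - Im l) < eps).
    rewrite <- E2, Rabs_minus_sym. change (Im l - Im S) with (Im (l - S)%C).
    eapply Rle_lt_trans; [apply im_le_Cmod|exact H0].
Qed.

Lemma CV_radius_gt_0 (e : nat -> R) s :
  0 < s -> ex_pseries e s -> Rbar_lt 0 (CV_radius e).
Proof.
  intros Hs He. apply Rbar_lt_le_trans with (Finite s); [exact Hs|].
  rewrite <- (Rabs_pos_eq s) by lra. apply Rbar_not_lt_le. intros Hlt.
  apply (CV_disk_outside e s Hlt).
  apply ex_series_lim_0. destruct He as [l Hl]. exists l. now apply is_pseries_R in Hl.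
Qed.

(** One-sided vanishing is enough: continuity at 0 kills the constant coefficient,
    and dividing by s reduces n + 1 to n. *)
Lemma pseries_zero_coef (n : nat) : forall (e : nat -> R) (d : R),
  0 < d -> (forall s, 0 < s < d -> is_pseries e s 0) -> e n = 0.
Proof.
  assert (Z : forall (e : nat -> R) d, 0 < d -> (forall s, 0 < s < d -> is_pseries e s 0) -> e O = 0).
  { intros e d Hd He.
    assert (R0 : Rbar_lt (Rabs 0) (CV_radius e)).
    { rewrite Rabs_R0. apply (CV_radius_gt_0 e (d / 2)); [lra|]. exists 0. apply He; lra. }
    pose proof (PSeries_continuity e 0 R0) as Ce.
    destruct (Req_dec (e O) 0) as [|Ne]; [assumption|exfalso].
    destruct (Ce (Rabs (e O)) (Rabs_pos_lt _ Ne)) as [al [Hal Hc]].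
    set (s := Rmin al d / 2).
    assert (Hs : 0 < s < al /\ s < d).
    { unfold s. pose proof (Rmin_l al d). pose proof (Rmin_r al d).
      assert (0 < Rmin al d) by (apply Rmin_pos; lra). lra. }
    specialize (Hc s). rewrite (is_pseries_unique _ _ _ (He s ltac:(lra))), PSeries_0 in Hc.
    unfold dist in Hc; simpl in Hc. unfold Rdist in Hc.
    rewrite Rminus_0_l, Rabs_Ropp in Hc. apply (Rlt_irrefl (Rabs (e O))), Hc.
    split; [split; [exact I|lra]|]. rewrite Rminus_0_r, Rabs_pos_eq; lra. }
  induction n as [|n IH]; intros e d Hd He; [eapply Z; eassumption|].
  apply (IH (PS_decr_1 e) d Hd). intros s Hs.
  pose proof (is_pseries_decr_1 e s (/ s) 0 (Rinv_l s ltac:(lra)) (He s Hs)) as Q.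
  rewrite (Z e d Hd He) in Q. evar_last; [exact Q|].
  unfold scal, plus, opp; simpl; unfold mult; simpl. ring.
Qed.

Lemma Re_mult_RtoC (w : C) (r : R) : Re (w * RtoC r) = Re w * r.
Proof. destruct w; unfold Re; simpl; ring. Qed.

Lemma Im_mult_RtoC (w : C) (r : R) : Im (w * RtoC r) = Im w * r.
Proof. destruct w; unfold Im; simpl; ring. Qed.

(** The difference of the two expansions at t x, restricted to the segment, is a
    real-variable power series in t - s; it vanishes for small positive t - s,
    hence identically, and this carries agreement past t. *)
Lemma analytic_agree_across (f g : C -> C) (x : C) (t eta : R) :
  analytic_at f (RtoC t * x) -> analytic_at g (RtoC t * x) -> 0 < eta ->
  (forall s, t - eta < s < t -> f (RtoC s * x)%C = g (RtoC s * x)%C) ->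
  exists d, 0 < d /\ forall s, Rabs (s - t) < d -> f (RtoC s * x)%C = g (RtoC s * x)%C.
Proof.
  intros (r1 & c1 & Hr1 & H1) (r2 & c2 & Hr2 & H2) Heta Hfg.
  pose proof (Cmod_ge_0 x) as Hx.
  set (d := Rmin r1 r2 / (Cmod x + 1)).
  assert (Hr : 0 < Rmin r1 r2) by (now apply Rmin_pos).
  assert (Hd : 0 < d) by (apply Rdiv_lt_0_compat; lra).
  (* Coefficients of the difference in the real variable t - s. *)
  set (e := fun n => ((c1 n - c2 n) * (- x) ^ n)%C).
  assert (HS : forall s, Rabs (s - t) < d ->
    is_series (V := C_NormedModule) (fun n => e n * RtoC ((t - s) ^ n))%C
      (f (RtoC s * x) - g (RtoC s * x))%C).
  { intros s Hs.
    assert (Hm : Cmod (RtoC s * x - RtoC t * x) < Rmin r1 r2).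
    { replace (RtoC s * x - RtoC t * x)%C with (RtoC (s - t) * x)%C by (rewrite RtoC_minus; ring).
      rewrite Cmod_mult, Cmod_R.
      assert (d * (Cmod x + 1) = Rmin r1 r2) by (unfold d; field; lra).
      pose proof (Rabs_pos (s - t)). nra. }
    pose proof (H1 (RtoC s * x)%C (Rlt_le_trans _ _ _ Hm (Rmin_l _ _))) as S1.
    pose proof (H2 (RtoC s * x)%C (Rlt_le_trans _ _ _ Hm (Rmin_r _ _))) as S2.
    eapply is_series_ext; [|exact (is_series_minus (V := C_NormedModule) _ _ _ _ S1 S2)].
    intros n. unfold e. rewrite RtoC_pow.
    replace (RtoC s * x - RtoC t * x)%C with (RtoC (t - s) * - x)%C by (rewrite RtoC_minus; ring).
    rewrite Cpow_mult_l. unfold minus, plus, opp; simpl. ring. }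
  assert (E0 : forall n, e n = 0%C).
  { assert (Hm : 0 < Rmin d eta) by now apply Rmin_pos.
    assert (P : forall s, 0 < s < Rmin d eta ->
      is_series (V := C_NormedModule) (fun n => e n * RtoC (s ^ n))%C (RtoC 0)).
    { intros s Hs. pose proof (Rmin_l d eta). pose proof (Rmin_r d eta).
      specialize (HS (t - s)). replace (t - (t - s)) with s in HS by ring.
      rewrite (Hfg (t - s)) in HS by lra.
      replace (RtoC 0) with (g (RtoC (t - s) * x) - g (RtoC (t - s) * x))%C by ring.
      apply HS. replace (t - s - t) with (- s) by ring. rewrite Rabs_Ropp, Rabs_pos_eq; lra. }
    intros n. destruct (e n) as [u v] eqn:En. apply injective_projections; simpl.
    - change u with (fst (u, v)). rewrite <- En.
      apply (pseries_zero_coef n (fun n => Re (e n)) (Rmin d eta) Hm). intros s Hs.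
      apply is_pseries_R. eapply is_series_ext; [|apply (proj1 (C_series_Re_Im _ _ (P s Hs)))].
      intros k. apply Re_mult_RtoC.
    - change v with (snd (u, v)). rewrite <- En.
      apply (pseries_zero_coef n (fun n => Im (e n)) (Rmin d eta) Hm). intros s Hs.
      apply is_pseries_R. eapply is_series_ext; [|apply (proj2 (C_series_Re_Im _ _ (P s Hs)))].
      intros k. apply Im_mult_RtoC. }
  exists d; split; [exact Hd|]. intros s Hs. specialize (HS s Hs).
  destruct (C_series_Re_Im _ _ HS) as [A B].
  assert (Zr : forall u : nat -> R, (forall n, u n = 0) -> forall l, is_series u l -> l = 0).
  { intros u Hu l Hl. rewrite <- (is_series_unique _ _ Hl). apply is_series_unique.
    apply is_series_ext with (fun n => 0 * 0 ^ n); [intros n; rewrite Hu; apply Rmult_0_l|].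
    evar_last; [apply (is_series_scal (V := R_NormedModule) 0), (is_series_geom 0)|].
    - rewrite Rabs_R0; lra.
    - unfold scal; simpl; unfold mult; simpl; ring. }
  apply Zr in A; [|intros n; rewrite E0, Re_mult_RtoC; apply Rmult_0_l].
  apply Zr in B; [|intros n; rewrite E0, Im_mult_RtoC; apply Rmult_0_l].
  unfold Re, Im in A, B; simpl in A, B. apply injective_projections; lra.
Qed.

Lemma slit_plane_star x s : slit_plane x -> 0 <= s <= 1 -> slit_plane (RtoC s * x)%C.
Proof.
  intros Hx Hs [H1 H2]. apply Hx. unfold Re, Im in *; simpl in *.
  rewrite Rmult_0_l, ?Rminus_0_r, ?Rplus_0_r in *.
  assert (s <> 0) by (intros ->; lra). split; [nra|].
  apply Rmult_integral in H2; tauto.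
Qed.

(** The slit plane is star-shaped about 0.  On the segment from 0 to x, the
    supremum of the parameters up to which f and g agree cannot be less than 1. *)
Lemma slit_plane_identity (f g : C -> C) :
  (forall x, slit_plane x -> analytic_at f x) ->
  (forall x, slit_plane x -> analytic_at g x) ->
  (forall x, Cmod x < 1 -> f x = g x) ->
  forall x, slit_plane x -> f x = g x.
Proof.
  intros Af Ag H1 x Hx.
  set (D := fun s => f (RtoC s * x)%C = g (RtoC s * x)%C).
  set (T := fun t => 0 <= t <= 1 /\ forall s, 0 <= s <= t -> D s).
  destruct (completeness T) as [m [Hub Hlub]].
  { exists 1. intros t Ht. apply Ht. }
  { exists 0. split; [lra|]. intros s Hs. replace s with 0 by lra. apply H1.
    rewrite Cmult_0_l, Cmod_0. lra. }
  pose proof (Cmod_ge_0 x) as Hmx.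
  assert (Hm0 : 0 < m).
  { set (t := Rmin 1 (/ (Cmod x + 1)) / 2).
    assert (Hi : 0 < / (Cmod x + 1)) by (apply Rinv_0_lt_compat; lra).
    assert (Ht : 0 < t <= 1 /\ t < / (Cmod x + 1)).
    { unfold t. pose proof (Rmin_l 1 (/ (Cmod x + 1))). pose proof (Rmin_r 1 (/ (Cmod x + 1))).
      assert (0 < Rmin 1 (/ (Cmod x + 1))) by (apply Rmin_pos; lra). lra. }
    apply Rlt_le_trans with t; [lra|]. apply Hub. split; [lra|]. intros s Hs. apply H1.
    rewrite Cmod_mult, Cmod_RtoC_nonneg by lra.
    assert (t * (Cmod x + 1) < 1).
    { replace 1 with (/ (Cmod x + 1) * (Cmod x + 1)) at 2 by (apply Rinv_l; lra).
      apply Rmult_lt_compat_r; lra. }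
    nra. }
  assert (Hm1 : m <= 1) by (apply Hlub; intros t Ht; apply Ht).
  assert (Hlt : forall s, 0 <= s < m -> D s).
  { intros s Hs. apply NNPP. intros Hn.
    assert (m <= s); [|lra]. apply Hlub. intros t [Ht Hts].
    destruct (Rle_dec t s) as [|Hgt]; [assumption|]. exfalso. apply Hn, Hts. lra. }
  pose proof (slit_plane_star x m Hx ltac:(lra)) as Hsm.
  destruct (analytic_agree_across f g x m m (Af _ Hsm) (Ag _ Hsm) Hm0) as [d [Hd Hnear]].
  { intros s Hs. apply Hlt; lra. }
  assert (Hle : forall s, 0 <= s < m + d -> D s).
  { intros s Hs. destruct (Rlt_dec s m); [apply Hlt; lra|].
    apply Hnear. rewrite Rabs_pos_eq; lra. }
  destruct (Rle_lt_or_eq_dec m 1 Hm1) as [Hl|He].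
  - exfalso. assert (Rmin 1 (m + d / 2) <= m).
    { pose proof (Rmin_l 1 (m + d / 2)). pose proof (Rmin_r 1 (m + d / 2)).
      apply Hub. split.
      - split; [apply Rmin_glb; lra|lra].
      - intros s Hs. apply Hle. lra. }
    unfold Rmin in *. destruct (Rle_dec 1 (m + d / 2)); lra.
  - specialize (Hle 1 ltac:(lra)). unfold D in Hle. now rewrite Cmult_1_l in Hle.
Qed.

Lemma Li_eq_polylog m x : (m <> 0)%nat -> slit_plane x -> Li m x = polylog m x.
Proof.
  intros Hm Hx. pose proof (polylog_is_polylog m Hm) as [P1 P2].
  assert (HL : is_polylog m (Li m)).
  { unfold Li. apply epsilon_spec. exists (polylog m). now split. }
  destruct HL as [L1 L2].
  apply slit_plane_identity; auto. intros y Hy.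
  exact (filterlim_locally_unique _ _ _ (L2 y Hy) (P2 y Hy)).
Qed.

(** * Derivatives of polylogarithms along curves *)

Lemma is_derive_squeeze_0 (g B : R -> R) (t : R) :
  B t = 0 -> is_derive B t 0 -> locally t (fun s => Rabs (g s) <= B s) -> is_derive g t 0.
Proof.
  intros B0 DB [d Hd]. apply is_derive_Reals. apply is_derive_Reals in DB.
  assert (g0 : g t = 0).
  { specialize (Hd t (ball_center t d)). rewrite B0 in Hd.
    pose proof (Rabs_pos (g t)). apply Rabs_eq_0. lra. }
  intros eps Heps. destruct (DB eps Heps) as [d' Hd'].
  assert (Hm : 0 < Rmin d d') by (apply Rmin_pos; [apply d|apply d']).
  exists (mkposreal _ Hm). simpl. intros h Hh Hhd.
  pose proof (Rmin_l d d'). pose proof (Rmin_r d d').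
  eapply Rle_lt_trans; [|apply (Hd' h Hh); lra].
  rewrite g0, B0, !Rminus_0_r. unfold Rdiv. rewrite !Rabs_mult.
  apply Rmult_le_compat_r; [apply Rabs_pos|].
  eapply Rle_trans; [apply Hd|apply Rle_abs].
  change (Rabs (t + h - t) < d). replace (t + h - t) with h by ring. lra.
Qed.

Lemma C_locally_curve (c : R -> C) (t r : R) :
  C_continuous c t -> 0 < r -> locally t (fun s => Cmod (c s - c t) < r).
Proof.
  intros [H1 H2] Hr.
  assert (Hr2 : 0 < r / 2) by lra.
  generalize (filter_and _ _
    (proj1 (filterlim_locally (F := locally t) _ _) H1 (mkposreal _ Hr2))
    (proj1 (filterlim_locally (F := locally t) _ _) H2 (mkposreal _ Hr2))).
  apply filter_imp. intros s [A B].
  change (Rabs (Re (c s) - Re (c t)) < r / 2) in A.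
  change (Rabs (Im (c s) - Im (c t)) < r / 2) in B.
  eapply Rle_lt_trans; [apply Cmod_le_Re_Im|].
  change (Rabs (Re (c s) - Re (c t)) + Rabs (Im (c s) - Im (c t)) < r). lra.
Qed.

(** Complex differentiability of f enters as a quadratic error bound, which is
    what the Taylor estimate of the polylogarithm provides. *)
Lemma is_C_derive_comp (f : C -> C) (c : R -> C) (t : R) (l a : C) (K r : R) :
  is_C_derive c t l -> 0 < r ->
  (forall w, Cmod (w - c t) < r -> Cmod (f w - f (c t) - a * (w - c t)) <= K * Cmod (w - c t) ^ 2) ->
  is_C_derive (fun s => f (c s)) t (a * l)%C.
Proof.
  intros Dc Hr Hf.
  set (g := fun s => (f (c s) - f (c t) - a * (c s - c t))%C).
  set (B := fun s => K * ((Re (c s) - Re (c t)) ^ 2 + (Im (c s) - Im (c t)) ^ 2)).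
  assert (HB : is_derive B t 0).
  { destruct (is_C_derive_minus _ _ _ _ _ Dc (is_C_derive_const (c t) t)) as [E1 E2].
    unfold B. evar_last.
    - apply (is_derive_scal (fun s => (Re (c s) - Re (c t)) ^ 2 + (Im (c s) - Im (c t)) ^ 2)).
      apply (is_derive_plus (V := R_NormedModule)); [apply (is_derive_pow _ 2 _ _ E1)|apply (is_derive_pow _ 2 _ _ E2)].
    - unfold scal, plus; simpl; unfold mult; simpl. ring. }
  assert (B0 : B t = 0) by (unfold B; ring).
  assert (Hg : locally t (fun s => Cmod (g s) <= B s)).
  { generalize (C_locally_curve c t r (is_C_derive_continuous _ _ _ Dc) Hr).
    apply filter_imp. intros s Hs. unfold g, B. eapply Rle_trans; [apply (Hf _ Hs)|].
    right. f_equal. rewrite Cmod2_alt. reflexivity. }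
  assert (Dg : is_C_derive g t 0%C).
  { split; apply (is_derive_squeeze_0 _ B t B0 HB);
      generalize Hg; apply filter_imp; intros s Hs; (eapply Rle_trans; [|exact Hs]);
      [apply re_le_Cmod|apply im_le_Cmod]. }
  pose proof (is_C_derive_minus _ _ _ _ _ Dg (is_C_derive_mult _ _ _ _ _ (is_C_derive_const (- a) t)
    (is_C_derive_minus _ _ _ _ _ Dc (is_C_derive_const (c t) t)))) as Q.
  pose proof (is_C_derive_minus _ _ _ _ _ Q (is_C_derive_const (- f (c t)) t)) as Q'.
  cbv beta in Q'.
  replace (0 - (0 * (c t - c t) + - a * (l - 0)) - 0)%C with (a * l)%C in Q' by ring.
  destruct Q' as [Q1 Q2].
  split; eapply is_derive_ext; try eassumption; intros s; cbv beta; unfold g; f_equal; ring.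
Qed.

Lemma weighted_int_ext k f g :
  (forall v, 0 < v < 1 -> f v = g v) -> weighted_int k f = weighted_int k g.
Proof.
  intros H. unfold weighted_int, CInt.
  f_equal; apply RInt_ext; rewrite Rmin_left, Rmax_right by lra; intros v Hv; now rewrite H.
Qed.

Lemma polylog_coef_at_0 k a d : off_cut a d -> polylog_coef k a 0 = polylog_int k a.
Proof.
  intros Ha. apply weighted_int_ext. intros v Hv.
  assert (Na : cut_factor a v <> 0%C) by (apply off_cut_neq0 with d; [assumption|lra]).
  change (RtoC (v ^ (2 * 0))) with (RtoC 1). rewrite Cpow_1_r. field. exact Na.
Qed.

Lemma polylog_int_derive k c t l :
  slit_plane (c t) -> is_C_derive c t l ->
  is_C_derive (fun s => polylog_int k (c s)) t (polylog_coef k (c t) 1 * l)%C.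
Proof.
  intros Ha Dc. destruct (slit_plane_off_cut _ Ha) as [d Hd].
  assert (Hd0 : 0 < d) by apply Hd.
  (* Within d / 2 of the centre the remaining distance to the cut is at least
     d / 2, so the degree 1 error 2 (h/d)^2 / (d - h) is at most 4 h^2 / d^3. *)
  apply is_C_derive_comp with (K := 4 / d ^ 3) (r := d / 2); [exact Dc|lra|].
  intros w Hw. set (h := Cmod (w - c t)) in *.
  assert (Hh : 0 <= h) by apply Cmod_ge_0.
  assert (Hwd : Cmod (w - c t) < d) by (fold h; lra).
  pose proof (polylog_taylor_error k _ d w _ 1 Hd (off_cut_near _ d w Hd Hwd)) as E.
  rewrite sum_Sn, sum_O, (polylog_coef_at_0 _ _ _ Hd) in E. fold h in E.
  eapply Rle_trans; [|eapply Rle_trans; [exact E|]].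
  - right. f_equal. unfold plus; simpl. ring.
  - pose proof (pow_INR_S_ge_1 2 (S k)) as P.
    assert (He : 0 < d - h) by lra.
    apply Rle_trans with (2 * ((h / d) ^ 2 / (d - h)) * 1).
    + unfold Rdiv at 1. apply Rmult_le_compat_l.
      * apply Rmult_le_pos; [lra|]. apply Rdiv_le_0_compat; [apply pow2_ge_0|exact He].
      * rewrite <- Rinv_1. apply Rinv_le_contravar; lra.
    + replace (4 / d ^ 3 * h ^ 2) with (2 * ((h / d) ^ 2 / (d / 2))) by (field; lra).
      rewrite Rmult_1_r. apply Rmult_le_compat_l; [lra|]. unfold Rdiv at 1 3.
      apply Rmult_le_compat_l; [apply pow2_ge_0|]. apply Rinv_le_contravar; lra.
Qed.

Lemma is_CInt_derive f df :
  (forall v, 0 <= v <= 1 -> is_C_derive f v (df v)) ->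
  (forall v, 0 <= v <= 1 -> C_continuous df v) -> is_CInt df (f 1 - f 0)%C.
Proof.
  intros D Cd. split.
  - apply (is_RInt_derive (V := R_CompleteNormedModule) (fun v => Re (f v)) (fun v => Re (df v)));
      rewrite Rmin_left, Rmax_right by lra; intros v Hv; [apply (D v Hv)|apply (Cd v Hv)].
  - apply (is_RInt_derive (V := R_CompleteNormedModule) (fun v => Im (f v)) (fun v => Im (df v)));
      rewrite Rmin_left, Rmax_right by lra; intros v Hv; [apply (D v Hv)|apply (Cd v Hv)].
Qed.

Lemma is_C_derive_inv_cut_factor a d v :
  off_cut a d -> 0 <= v <= 1 ->
  is_C_derive (fun v => / cut_factor a v)%C v (a * RtoC (2 * v) / cut_factor a v ^ 2)%C.
Proof.
  intros Ha Hv. pose proof (off_cut_neq0 a d v Ha Hv) as Na.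
  assert (D : is_C_derive (cut_factor a) v (0 - (0 * RtoC (v ^ 2) + a * RtoC (2 * v)))%C).
  { apply is_C_derive_minus; [apply is_C_derive_const|].
    apply (is_C_derive_mult (fun _ => a) (fun v => RtoC (v ^ 2))); [apply is_C_derive_const|].
    apply is_C_derive_RtoC. auto_derive; [exact I|ring]. }
  pose proof (is_C_derive_inv _ _ _ D Na) as Q.
  apply (is_C_derive_eq _ _ _ _ Q). (field; exact Na).
Qed.

(** Integration by parts with g = 1 / (1 - a v^2): here g + v g'/2 is
    1 / (1 - a v^2)^2, the integrand of the derivative of x times the integral.
    This is the relation x Li_(k+2)' = Li_(k+1). *)
Lemma polylog_int_lower k a d :
  off_cut a d -> weighted_int (S k) (fun v => / cut_factor a v ^ 2)%C = polylog_int k a.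
Proof.
  intros Ha.
  set (g := fun v => (/ cut_factor a v)%C).
  set (g' := fun v => (a * RtoC (2 * v) / cut_factor a v ^ 2)%C).
  assert (Cg' : forall v, 0 <= v <= 1 -> C_continuous g' v).
  { intros v Hv. unfold g', Cdiv. apply C_continuous_mult.
    - apply C_continuous_mult; [apply C_continuous_const|].
      apply C_continuous_RtoC, (ex_derive_continuous (V := R_NormedModule)). auto_derive; exact I.
    - now apply C_continuous_inv_cut_factor_pow with d. }
  assert (Z : is_CInt (fun v => RtoC (log_weight (S k) v) * (g v + RtoC (v / 2) * g' v)
                              - RtoC (log_weight k v) * g v)%C 0%C).
  { split.
    - eapply is_RInt_ext; [|apply (log_weight_by_parts k (fun v => Re (g v)) (fun v => Re (g' v)))].
      + intros v _. cbv beta. destruct (g v), (g' v). unfold Re; simpl. field.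
      + intros v Hv. apply (is_C_derive_inv_cut_factor a d v Ha Hv).
      + intros v Hv. apply (Cg' v Hv).
    - eapply is_RInt_ext; [|apply (log_weight_by_parts k (fun v => Im (g v)) (fun v => Im (g' v)))].
      + intros v _. cbv beta. destruct (g v), (g' v). unfold Im; simpl. field.
      + intros v Hv. apply (is_C_derive_inv_cut_factor a d v Ha Hv).
      + intros v Hv. apply (Cg' v Hv). }
  assert (Q : is_CInt (fun v => RtoC (log_weight k v) * g v)%C (polylog_int k a)).
  { apply is_CInt_weighted. intros v Hv. now apply C_continuous_inv_cut_factor with d. }
  apply is_CInt_unique.
  replace (polylog_int k a) with (0 + polylog_int k a)%C by ring.
  eapply is_CInt_ext; [|apply (is_CInt_plus _ _ _ _ Z Q)].
  intros v Hv. cbv beta. unfold g, g'.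
  assert (Na : cut_factor a v <> 0%C) by (apply off_cut_neq0 with d; [assumption|lra]).
  replace (RtoC (v / 2) * (a * RtoC (2 * v) / cut_factor a v ^ 2))%C with
    (a * RtoC (v ^ 2) / cut_factor a v ^ 2)%C.
  - replace (/ cut_factor a v ^ 2)%C with
     (/ cut_factor a v + a * RtoC (v ^ 2) / cut_factor a v ^ 2)%C; [ring|].
    unfold cut_factor in *. field. exact Na.
  - replace (v ^ 2) with (v / 2 * (2 * v)) by field. rewrite RtoC_mult. field. exact Na.
Qed.

(** An antiderivative of 2 v / (1 - a v^2)^2 is v^2 / (1 - a v^2). *)
Lemma weighted_int_0_inv_sqr a d :
  off_cut a d -> weighted_int 0 (fun v => / cut_factor a v ^ 2)%C = (/ (1 - a))%C.
Proof.
  intros Ha. apply is_CInt_unique.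
  assert (N1 : (1 - a)%C <> 0%C).
  { replace (1 - a)%C with (cut_factor a 1) by (unfold cut_factor; rewrite pow1; ring).
    apply off_cut_neq0 with d; [assumption|lra]. }
  set (f := fun v => (RtoC (v ^ 2) * / cut_factor a v)%C).
  replace (/ (1 - a))%C with (f 1 - f 0)%C.
  - apply (is_CInt_ext (fun v => RtoC (2 * v) * / cut_factor a v ^ 2)%C).
    { intros v _. f_equal. f_equal. unfold log_weight. simpl. field. }
    apply is_CInt_derive; intros v Hv.
    + assert (Na : cut_factor a v <> 0%C) by (apply off_cut_neq0 with d; assumption).
      pose proof (is_C_derive_mult (fun v => RtoC (v ^ 2)) _ v (RtoC (2 * v)) _
        ltac:(apply is_C_derive_RtoC; auto_derive; [exact I|ring])
        (is_C_derive_inv_cut_factor a d v Ha Hv)) as Q.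
      apply (is_C_derive_eq _ _ _ _ Q). cbv beta.
      unfold cut_factor in *. field. exact Na.
    + apply C_continuous_mult; [|now apply C_continuous_inv_cut_factor_pow with d].
      apply C_continuous_RtoC, (ex_derive_continuous (V := R_NormedModule)). auto_derive; exact I.
  - unfold f, cut_factor. rewrite pow1, pow_i by lia. field. exact N1.
Qed.

Lemma polylog_derive_weighted k c t l :
  slit_plane (c t) -> is_C_derive c t l ->
  is_C_derive (fun s => polylog (S k) (c s)) t
    (weighted_int k (fun v => / cut_factor (c t) v ^ 2) * l)%C.
Proof.
  intros Ha Dc. destruct (slit_plane_off_cut _ Ha) as [d Hd].
  pose proof (is_C_derive_mult _ _ _ _ _ Dc (polylog_int_derive k c t l Ha Dc)) as Q.
  apply (is_C_derive_eq _ _ _ _ Q). cbv beta.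
  replace (weighted_int k (fun v => / cut_factor (c t) v ^ 2)%C)
    with (polylog_int k (c t) + c t * polylog_coef k (c t) 1)%C; [ring|].
  symmetry; apply is_CInt_unique.
  eapply is_CInt_ext; [|apply is_CInt_plus; [apply is_CInt_weighted|apply is_CInt_scal, is_CInt_weighted]].
  - intros v Hv.
    assert (Na : cut_factor (c t) v <> 0%C) by (apply off_cut_neq0 with d; [assumption|lra]).
    change (2 * 1)%nat with 2%nat. unfold cut_factor in *. field. exact Na.
  - intros v Hv. now apply C_continuous_inv_cut_factor with d.
  - intros v Hv. apply C_continuous_mult; [apply C_continuous_RtoC_pow|].
    now apply C_continuous_inv_cut_factor_pow with d.
Qed.

(** The factor [polylog_int k (c t)] is Li_(k+1)(c t) / (c t), in a form that also
    makes sense when c t = 0. *)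
Lemma polylog_derive k c t l :
  slit_plane (c t) -> is_C_derive c t l ->
  is_C_derive (fun s => polylog (S (S k)) (c s)) t (polylog_int k (c t) * l)%C.
Proof.
  intros Ha Dc. destruct (slit_plane_off_cut _ Ha) as [d Hd].
  rewrite <- (polylog_int_lower k _ d Hd). now apply polylog_derive_weighted.
Qed.

Lemma polylog_1_derive c t l :
  slit_plane (c t) -> is_C_derive c t l ->
  is_C_derive (fun s => polylog 1 (c s)) t (/ (1 - c t) * l)%C.
Proof.
  intros Ha Dc. destruct (slit_plane_off_cut _ Ha) as [d Hd].
  rewrite <- (weighted_int_0_inv_sqr _ d Hd). now apply polylog_derive_weighted.
Qed.

(** * Limits at zero and functions determined by their derivative *)

Lemma is_derive_Rminus (f g : R -> R) (x df dg : R) :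
  is_derive f x df -> is_derive g x dg -> is_derive (fun t => f t - g t) x (df - dg).
Proof. exact (is_derive_minus (V := R_NormedModule) f g x df dg). Qed.

Lemma is_derive_Rplus (f g : R -> R) (x df dg : R) :
  is_derive f x df -> is_derive g x dg -> is_derive (fun t => f t + g t) x (df + dg).
Proof. exact (is_derive_plus (V := R_NormedModule) f g x df dg). Qed.

Lemma continuous_Rplus (f g : R -> R) (x : R) :
  continuous f x -> continuous g x -> continuous (fun t => f t + g t) x.
Proof. exact (continuous_plus (V := R_NormedModule) f g x). Qed.

Lemma is_derive_Rmult (f g : R -> R) (x df dg : R) :
  is_derive f x df -> is_derive g x dg -> is_derive (fun t => f t * g t) x (df * g x + f x * dg).
Proof.
  intros H1 H2. exact (is_derive_mult (K := R_AbsRing) f g x df dg H1 H2 Rmult_comm).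
Qed.

Lemma is_derive_Rscal (f : R -> R) (k x df : R) :
  is_derive f x df -> is_derive (fun t => k * f t) x (k * df).
Proof. apply (is_derive_scal f x k df). Qed.

Definition tends0 (f : R -> R) (l : R) : Prop := filterlim f (at_right 0) (locally l).

Lemma tends0_continuous (f : R -> R) (l : R) :
  continuous f 0 -> f 0 = l -> tends0 f l.
Proof.
  intros C <-. eapply filterlim_filter_le_1; [|exact C].
  apply filter_le_within.
Qed.

Lemma tends0_plus f g lf lg : tends0 f lf -> tends0 g lg -> tends0 (fun z => f z + g z) (lf + lg).
Proof.
  intros H1 H2. exact (filterlim_comp_2 f g Rplus H1 H2 (filterlim_plus (V := R_NormedModule) lf lg)).
Qed.

Lemma tends0_mult f g lf lg : tends0 f lf -> tends0 g lg -> tends0 (fun z => f z * g z) (lf * lg).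
Proof.
  intros H1 H2. exact (filterlim_comp_2 f g Rmult H1 H2 (filterlim_mult (K := R_AbsRing) lf lg)).
Qed.

Lemma tends0_const c : tends0 (fun _ => c) c.
Proof. apply filterlim_const. Qed.

Lemma tends0_id : tends0 (fun z => z) 0.
Proof. apply tends0_continuous; [apply continuous_id|reflexivity]. Qed.

Lemma tends0_minus f g lf lg : tends0 f lf -> tends0 g lg -> tends0 (fun z => f z - g z) (lf - lg).
Proof.
  intros H1 H2.
  replace (lf - lg) with (lf + (-1) * lg) by ring.
  apply filterlim_ext with (fun z => f z + (-1) * g z); [intros; simpl; ring|].
  apply tends0_plus; [assumption|]. apply tends0_mult; [apply tends0_const|assumption].
Qed.

Lemma tends0_pow f l n : tends0 f l -> tends0 (fun z => f z ^ n) (l ^ n).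
Proof.
  intros H. induction n as [|n IH]; [apply tends0_const|]. now apply tends0_mult.
Qed.

Lemma at_right_0_interval (b : R) (P : R -> Prop) :
  0 < b -> (forall z, 0 < z < b -> P z) -> at_right 0 P.
Proof.
  intros Hb HP. exists (mkposreal b Hb). intros y Hy Hy0. change (Rabs (y - 0) < b) in Hy.
  rewrite Rminus_0_r, Rabs_pos_eq in Hy by lra. apply HP; lra.
Qed.

Lemma tends0_ext f g l b :
  0 < b -> (forall z, 0 < z < b -> f z = g z) -> tends0 f l -> tends0 g l.
Proof.
  intros Hb E. apply filterlim_ext_loc. now apply at_right_0_interval with b.
Qed.

Lemma tends0_scal f k l : tends0 f l -> tends0 (fun z => k * f z) (k * l).
Proof. apply tends0_mult, tends0_const. Qed.

Lemma tends0_squeeze f g l b :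
  0 < b -> (forall z, 0 < z < b -> Rabs (f z - l) <= g z) -> tends0 g 0 -> tends0 f l.
Proof.
  intros Hb Hf Hg. apply (filterlim_locally (F := at_right 0) f l). intros eps.
  generalize (filter_and (F := at_right 0) _ _ (at_right_0_interval b _ Hb Hf)
    (proj1 (filterlim_locally (F := at_right 0) g 0) Hg eps)).
  apply filter_imp. intros z [H1 H2]. change (Rabs (g z - 0) < eps) in H2.
  change (Rabs (f z - l) < eps). rewrite Rminus_0_r in H2.
  eapply Rle_lt_trans; [exact H1|]. eapply Rle_lt_trans; [apply Rle_abs|exact H2].
Qed.

Lemma constant_on_interval (f : R -> R) (b : R) :
  (forall x, 0 < x < b -> is_derive f x 0) ->
  forall x y, 0 < x < b -> 0 < y < b -> f x = f y.
Proof.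
  intros D x y Hx Hy.
  assert (Hin : forall w, Rmin y x <= w <= Rmax y x -> 0 < w < b).
  { intros w Hw. unfold Rmin, Rmax in Hw. destruct (Rle_dec y x); lra. }
  destruct (MVT_gen f y x (fun _ => 0)) as [c [_ E]].
  - intros w Hw. apply D, Hin. lra.
  - intros w Hw. apply continuity_pt_filterlim.
    apply (ex_derive_continuous (V := R_NormedModule)). exists 0. now apply D, Hin.
  - lra.
Qed.

Lemma constant_from_limit (f : R -> R) (b l : R) :
  (forall x, 0 < x < b -> is_derive f x 0) -> tends0 f l ->
  forall x, 0 < x < b -> f x = l.
Proof.
  intros D L x Hx.
  apply (filterlim_locally_unique (F := at_right 0) (fun _ => f x) (f x) l);
    [apply filterlim_const|].
  apply filterlim_ext_loc with (2 := L).
  apply at_right_0_interval with b; [lra|].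
  intros y Hy. now apply (constant_on_interval f b D).
Qed.

(** Derivatives are compared only on the open interval, since the derivatives met
    below contain cot z; limits at 0 replace initial values. *)
Lemma eq_from_derive (f g : R -> R) (df : R -> R) :
  (forall z, 0 < z < PI / 2 -> is_derive f z (df z)) ->
  (forall z, 0 < z < PI / 2 -> is_derive g z (df z)) ->
  (exists l, tends0 f l /\ tends0 g l) ->
  forall z, 0 < z < PI / 2 -> f z = g z.
Proof.
  intros Df Dg [l [Lf Lg]] z Hz.
  assert (E : f z - g z = 0); [|lra].
  apply (constant_from_limit (fun z => f z - g z) (PI / 2) 0); [| |exact Hz].
  - intros x Hx. evar_last; [apply is_derive_Rminus; [apply Df, Hx|apply Dg, Hx]|ring].
  - rewrite <- (Rminus_diag l). now apply tends0_minus.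
Qed.

(** * The central binomial series *)

(** Coefficients in y = sin^2 z of the series divided by y, so that index n
    stands for the term n + 1. *)
Definition central_binomial_coef (p n : nat) : R :=
  4 ^ S n / (INR (S n) ^ p * Binomial.C (2 * S n) (S n)).

Lemma central_binomial_pos n : 0 < Binomial.C (2 * n) n.
Proof.
  unfold Binomial.C. apply Rdiv_lt_0_compat; [apply INR_fact_lt_0|].
  apply Rmult_lt_0_compat; apply INR_fact_lt_0.
Qed.

Lemma central_binomial_S n :
  Binomial.C (2 * S n) (S n) * INR (S n) = 2 * (2 * INR n + 1) * Binomial.C (2 * n) n.
Proof.
  unfold Binomial.C. replace (2 * S n - S n)%nat with (S n) by lia.
  replace (2 * n - n)%nat with n by lia. replace (2 * S n)%nat with (S (S (2 * n))) by lia.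
  rewrite !fact_simpl, !mult_INR, !S_INR, mult_INR. change (INR 2) with 2.
  pose proof (INR_fact_neq_0 n). pose proof (pos_INR n). field. repeat split; try assumption; lra.
Qed.

Lemma central_binomial_coef_pos p n : 0 < central_binomial_coef p n.
Proof.
  unfold central_binomial_coef. apply Rdiv_lt_0_compat; [apply pow_lt; lra|].
  apply Rmult_lt_0_compat; [|apply central_binomial_pos].
  apply pow_lt, lt_0_INR; lia.
Qed.

Lemma central_binomial_coef_rec n :
  (2 * INR n + 3) * central_binomial_coef 0 (S n) = 2 * (INR n + 2) * central_binomial_coef 0 n.
Proof.
  unfold central_binomial_coef. pose proof (central_binomial_S (S n)) as E.
  pose proof (central_binomial_pos (S n)) as P1. pose proof (central_binomial_pos (S (S n))) as P2.
  set (A := Binomial.C (2 * S (S n)) (S (S n))) in *. set (B := Binomial.C (2 * S n) (S n)) in *.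
  rewrite !S_INR in E. pose proof (pos_INR n). simpl pow.
  assert (EA : A = 2 * (2 * (INR n + 1) + 1) * B / (INR n + 1 + 1)) by (rewrite <- E; field; lra).
  rewrite EA. field. lra.
Qed.

Lemma central_binomial_coef_lower p n :
  INR (S n) * central_binomial_coef (S p) n = central_binomial_coef p n.
Proof.
  unfold central_binomial_coef. pose proof (central_binomial_pos (S n)).
  assert (HS : INR (S n) <> 0) by (apply not_0_INR; lia). rewrite <- (tech_pow_Rmult (INR (S n))).
  field. split; [lra|split; [|assumption]]. now apply pow_nonzero.
Qed.

Lemma is_lim_seq_inv_INR_S : is_lim_seq (fun n => / INR (S n)) 0.
Proof.
  apply (proj1 (is_lim_seq_incr_1 (fun n => / INR n) 0)).
  evar_last; [apply is_lim_seq_inv with (l := p_infty); [apply is_lim_seq_INR|easy]|reflexivity].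
Qed.

(** The ratio test: the quotients for p = 0 are 1 + 1 / (2 n + 3), and raising p
    multiplies them by (n + 1) / (n + 2). *)
Lemma central_binomial_coef_CV_radius p : CV_radius (central_binomial_coef p) = 1.
Proof.
  rewrite <- Rinv_1 at 1. apply CV_radius_finite_DAlembert; [|lra|].
  { intros n. pose proof (central_binomial_coef_pos p n); lra. }
  assert (Hn : forall n, 0 < INR (S n)) by (intros n; apply lt_0_INR; lia).
  induction p as [|p IH].
  - apply is_lim_seq_ext with (fun n => 1 + / INR (S (S (S (2 * n))))).
    + intros n. pose proof (central_binomial_coef_pos 0 n). pose proof (central_binomial_coef_pos 0 (S n)).
      rewrite Rabs_pos_eq by (apply Rdiv_le_0_compat; lra).
      pose proof (central_binomial_coef_rec n) as E. pose proof (pos_INR n).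
      rewrite !S_INR, mult_INR. change (INR 2) with 2.
      assert (E' : central_binomial_coef 0 (S n) = 2 * (INR n + 2) * central_binomial_coef 0 n / (2 * INR n + 3))
        by (rewrite <- E; field; lra).
      rewrite E'. field. lra.
    + evar_last.
      * apply is_lim_seq_plus'; [apply is_lim_seq_const|].
        apply (is_lim_seq_subseq (fun n => / INR (S n)) 0 (fun n => S (S (2 * n)))).
        -- apply eventually_subseq. intros n. lia.
        -- apply is_lim_seq_inv_INR_S.
      * f_equal; ring.
  - apply is_lim_seq_ext with (fun n => Rabs (central_binomial_coef p (S n) / central_binomial_coef p n)
                                         * (1 - / INR (S (S n)))).
    + intros n. rewrite <- (central_binomial_coef_lower p (S n)), <- (central_binomial_coef_lower p n).
      pose proof (central_binomial_coef_pos (S p) n). pose proof (central_binomial_coef_pos (S p) (S n)).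
      pose proof (Hn n). pose proof (Hn (S n)).
      rewrite !Rabs_pos_eq by (apply Rdiv_le_0_compat; nra).
      rewrite (S_INR (S n)) in *. field. lra.
    + evar_last.
      * apply is_lim_seq_mult'; [apply IH|].
        apply is_lim_seq_minus'; [apply is_lim_seq_const|].
        apply (proj1 (is_lim_seq_incr_1 (fun n => / INR (S n)) 0)), is_lim_seq_inv_INR_S.
      * f_equal; ring.
Qed.

Lemma central_binomial_coef_in_disk p y : 0 <= y < 1 -> Rbar_lt (Rabs y) (CV_radius (central_binomial_coef p)).
Proof. intros H. rewrite central_binomial_coef_CV_radius, Rabs_pos_eq; simpl; lra. Qed.

Definition central_binomial_gf (p : nat) (y : R) : R := PSeries (PS_incr_1 (central_binomial_coef p)) y.

Lemma central_binomial_gf_factor p y : central_binomial_gf p y = y * PSeries (central_binomial_coef p) y.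
Proof. apply PSeries_incr_1. Qed.

Lemma central_binomial_gf_derive p y :
  0 <= y < 1 -> is_derive (central_binomial_gf (S p)) y (PSeries (central_binomial_coef p) y).
Proof.
  intros Hy. evar_last.
  - apply is_derive_PSeries. rewrite CV_radius_incr_1. now apply central_binomial_coef_in_disk.
  - apply PSeries_ext. intros n. apply central_binomial_coef_lower.
Qed.

(** The power series form of the recurrence of the central binomial coefficients. *)
Lemma central_binomial_ode y :
  0 <= y < 1 ->
  2 * (1 - y) * PSeries (central_binomial_coef 0) y = PSeries (central_binomial_coef 1) y + 2.
Proof.
  intros Hy.
  assert (X : forall p, ex_pseries (central_binomial_coef p) y).
  { intros p. apply CV_radius_inside. now apply central_binomial_coef_in_disk. }
  assert (X' : forall p, ex_pseries (PS_decr_1 (central_binomial_coef p)) y).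
  { intros p. apply CV_radius_inside. rewrite CV_radius_decr_1. now apply central_binomial_coef_in_disk. }
  assert (E : 2 * (PSeries (PS_decr_1 (central_binomial_coef 0)) y - PSeries (central_binomial_coef 0) y)
            = PSeries (PS_decr_1 (central_binomial_coef 1)) y).
  { rewrite <- PSeries_minus, <- PSeries_scal by auto. apply PSeries_ext. intros n.
    unfold PS_scal, PS_minus, PS_plus, PS_opp, PS_decr_1. unfold scal, plus, opp; simpl; unfold mult; simpl.
    pose proof (central_binomial_coef_rec n) as Er.
    pose proof (central_binomial_coef_lower 0 (S n)) as El. rewrite !S_INR in El.
    pose proof (pos_INR n). apply Rmult_eq_reg_l with (INR n + 1 + 1); [|lra]. rewrite El. nra. }
  rewrite (PSeries_decr_1 (central_binomial_coef 1)) by auto.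
  rewrite <- E. pose proof (PSeries_decr_1 (central_binomial_coef 0) y (X 0%nat)) as E'.
  assert (E0 : central_binomial_coef 0 0 = 2) by (unfold central_binomial_coef, Binomial.C; simpl; field).
  assert (E1 : central_binomial_coef 1 0 = 2) by (unfold central_binomial_coef, Binomial.C; simpl; field).
  rewrite E0 in E'. rewrite E1. lra.
Qed.

Definition central_binomial_sum (p : nat) (z : R) : R := central_binomial_gf p (sin z ^ 2).

Lemma sin_sqr_lt_1 z : - (PI / 2) < z < PI / 2 -> 0 <= sin z ^ 2 < 1.
Proof.
  intros H. pose proof (cos_gt_0 z ltac:(lra) ltac:(lra)).
  pose proof (sin2_cos2 z) as E. unfold Rsqr in E. nra.
Qed.

Lemma central_binomial_sum_series p z :
  - (PI / 2) < z < PI / 2 -> is_series (central_binomial_term p z) (central_binomial_sum p z).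
Proof.
  intros Hz. unfold central_binomial_sum. rewrite central_binomial_gf_factor.
  assert (X : is_pseries (central_binomial_coef p) (sin z ^ 2) (PSeries (central_binomial_coef p) (sin z ^ 2))).
  { apply PSeries_correct, CV_radius_inside, central_binomial_coef_in_disk, sin_sqr_lt_1, Hz. }
  apply is_pseries_R in X.
  eapply is_series_ext; [|apply (is_series_scal (V := R_NormedModule) (sin z ^ 2) _ _ X)].
  intros n.
  change (sin z ^ 2 * (central_binomial_coef p n * (sin z ^ 2) ^ n) = central_binomial_term p z n).
  unfold central_binomial_coef, central_binomial_term, Rdiv.
  rewrite (pow_mult (2 * sin z)), !Rpow_mult_distr. replace (2 ^ 2) with 4 by ring.
  rewrite <- (tech_pow_Rmult (sin z ^ 2)). ring.
Qed.

Lemma central_binomial_sum_0 p : central_binomial_sum p 0 = 0.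
Proof. unfold central_binomial_sum. rewrite central_binomial_gf_factor, sin_0. ring. Qed.

Lemma central_binomial_sum_derive_PSeries p z :
  - (PI / 2) < z < PI / 2 ->
  is_derive (central_binomial_sum (S p)) z
    (2 * sin z * cos z * PSeries (central_binomial_coef p) (sin z ^ 2)).
Proof.
  intros Hz. unfold central_binomial_sum. evar_last.
  - apply (is_derive_comp (central_binomial_gf (S p)) (fun z => sin z ^ 2)).
    + apply central_binomial_gf_derive, sin_sqr_lt_1, Hz.
    + instantiate (1 := 2 * sin z * cos z). auto_derive; [exact I|ring].
  - unfold scal; simpl; unfold mult; simpl. ring.
Qed.

Lemma central_binomial_sum_derive p z :
  0 < z < PI / 2 ->
  is_derive (central_binomial_sum (S p)) z (2 * (cos z / sin z) * central_binomial_sum p z).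
Proof.
  intros Hz. evar_last; [apply central_binomial_sum_derive_PSeries; lra|].
  unfold central_binomial_sum. rewrite central_binomial_gf_factor.
  pose proof (sin_gt_0 z ltac:(lra) ltac:(lra)). field. lra.
Qed.

(** By the differential equation the left side has constant derivative 2. *)
Lemma sin_cos_PSeries z :
  0 < z < PI / 2 -> sin z * cos z * PSeries (central_binomial_coef 1) (sin z ^ 2) = 2 * z.
Proof.
  set (U := PSeries (central_binomial_coef 1)).
  set (U' := PSeries (PS_derive (central_binomial_coef 1))).
  set (Q := fun z => sin z * cos z * U (sin z ^ 2)).
  assert (DU : forall y, 0 <= y < 1 -> is_derive U y (U' y)).
  { intros y Hy. apply is_derive_PSeries. now apply central_binomial_coef_in_disk. }
  assert (DQ : forall z, - (PI / 2) < z < PI / 2 -> is_derive Q z 2).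
  { clear z. intros z Hz. pose proof (sin_sqr_lt_1 z Hz) as Hy. set (y := sin z ^ 2) in *.
    assert (E1 : PSeries (central_binomial_coef 0) y = U y + y * U' y).
    { rewrite <- (is_derive_unique _ _ _ (central_binomial_gf_derive 0 y Hy)).
      apply is_derive_unique. apply (is_derive_ext (fun y => y * U y)).
      - intros t. symmetry. apply central_binomial_gf_factor.
      - evar_last; [apply (is_derive_mult (K := R_AbsRing) (fun y => y) U _ _ _ (is_derive_id y) (DU y Hy))|].
        + intros; apply Rmult_comm.
        + unfold plus, mult, one; simpl. ring. }
    pose proof (central_binomial_ode y Hy) as E2. fold U in E2. rewrite E1 in E2.
    assert (D1 : is_derive (fun z => U (sin z ^ 2)) z (2 * sin z * cos z * U' y)).
    { apply (is_derive_comp U (fun z => sin z ^ 2)); [now apply DU|auto_derive; [exact I|ring]]. }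
    assert (D2 : is_derive (fun z => sin z * cos z) z (cos z ^ 2 - sin z ^ 2))
      by (auto_derive; [exact I|ring]).
    evar_last; [apply (is_derive_mult (K := R_AbsRing) _ _ _ _ _ D2 D1); intros; apply Rmult_comm|].
    unfold plus, mult; simpl plus; simpl mult.
    pose proof (sin2_cos2 z) as S2. rewrite !Rsqr_pow2 in S2. fold y in S2.
    change ((cos z ^ 2 - sin z ^ 2) * U (sin z ^ 2) + sin z * cos z * (2 * sin z * cos z * U' y) = 2).
    fold y. replace (sin z * cos z * (2 * sin z * cos z * U' y)) with (2 * y * cos z ^ 2 * U' y) by (unfold y; ring).
    replace (cos z ^ 2) with (1 - y) by lra. lra. }
  intros Hz. change (Q z = 2 * z).
  assert (E : Q z - 2 * z = 0); [|lra].
  apply (constant_from_limit (fun z => Q z - 2 * z) (PI / 2) 0); [| |exact Hz].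
  - intros x Hx. evar_last.
    + apply (is_derive_Rminus Q (fun z => 2 * z) x 2 2); [apply DQ; lra|auto_derive; [exact I|ring]].
    + ring.
  - apply tends0_continuous.
    + apply (continuous_minus (V := R_NormedModule) Q (fun z => 2 * z)).
      * apply (ex_derive_continuous (V := R_NormedModule)). exists 2. apply DQ. pose proof PI_RGT_0; lra.
      * apply (ex_derive_continuous (V := R_NormedModule)). auto_derive; exact I.
    + unfold Q. rewrite sin_0. ring.
Qed.

Lemma central_binomial_sum_2 z : 0 < z < PI / 2 -> central_binomial_sum 2 z = 2 * z ^ 2.
Proof.
  intros Hz. assert (E : central_binomial_sum 2 z - 2 * z ^ 2 = 0); [|lra].
  apply (constant_from_limit (fun z => central_binomial_sum 2 z - 2 * z ^ 2) (PI / 2) 0); [| |exact Hz].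
  - intros x Hx. evar_last.
    + apply (is_derive_Rminus (central_binomial_sum 2) (fun z => 2 * z ^ 2));
        [apply central_binomial_sum_derive_PSeries; lra|].
      instantiate (1 := 4 * x). auto_derive; [exact I|ring].
    + pose proof (sin_cos_PSeries x Hx) as E. lra.
  - apply tends0_continuous.
    + apply (continuous_minus (V := R_NormedModule) (central_binomial_sum 2) (fun z => 2 * z ^ 2)).
      * apply (ex_derive_continuous (V := R_NormedModule)). eexists.
        apply central_binomial_sum_derive_PSeries. pose proof PI_RGT_0; lra.
      * apply (ex_derive_continuous (V := R_NormedModule)). auto_derive; exact I.
    + rewrite central_binomial_sum_0. ring.
Qed.

(** * Log-sine integrals *)

Definition log_sine_ratio (z t : R) : R := ln (sin t / sin z).

(** Rewriting through [log_weight] transfers its continuity at 0 to the boundary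
    terms of the log-sine integrals. *)
Lemma sin_mul_log_pow k z t :
  0 < z < PI / 2 ->
  sin t * log_sine_ratio z t ^ k =
    sin z * INR (fact k) / (2 * (-2) ^ k) * log_weight k (sin t / sin z).
Proof.
  intros Hz. pose proof (sin_gt_0 z ltac:(lra) ltac:(lra)).
  unfold log_weight, log_sine_ratio. rewrite Rpow_mult_distr.
  assert ((-2) ^ k <> 0) by (apply pow_nonzero; lra). pose proof (INR_fact_neq_0 k).
  field. repeat split; try assumption; lra.
Qed.

Lemma central_binomial_log_continuous_0 p k z :
  0 < z < PI / 2 ->
  continuous (fun t => central_binomial_sum p t * log_sine_ratio z t ^ k) 0.
Proof.
  intros Hz. pose proof (sin_gt_0 z ltac:(lra) ltac:(lra)) as Hs. pose proof PI_RGT_0 as HPI.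
  apply (continuous_ext (fun t => (sin t * PSeries (central_binomial_coef p) (sin t ^ 2)) *
      (sin z * INR (fact k) / (2 * (-2) ^ k) * log_weight k (sin t / sin z)))).
  { intros t. rewrite <- sin_mul_log_pow by exact Hz.
    unfold central_binomial_sum. rewrite central_binomial_gf_factor.
    match goal with |- ?a = ?b => change (@eq R a b) end. ring. }
  assert (Cs : continuous sin 0).
  { apply (ex_derive_continuous (V := R_NormedModule)). auto_derive; exact I. }
  apply (continuous_mult (K := R_AbsRing)).
  - apply (continuous_mult (K := R_AbsRing)); [exact Cs|].
    apply (continuous_comp (fun t => sin t ^ 2) (PSeries (central_binomial_coef p))).
    + apply (ex_derive_continuous (V := R_NormedModule)). auto_derive; exact I.
    + apply continuity_pt_filterlim, PSeries_continuity, central_binomial_coef_in_disk.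
      apply sin_sqr_lt_1. lra.
  - apply (continuous_mult (K := R_AbsRing)); [apply continuous_const|].
    apply (continuous_comp (fun t => sin t / sin z) (log_weight k)).
    + apply (ex_derive_continuous (V := R_NormedModule)). auto_derive; lra.
    + apply log_weight_continuous. rewrite sin_0. unfold Rdiv; lra.
Qed.

Lemma log_sine_ratio_derive z t :
  0 < z < PI / 2 -> 0 < t < PI / 2 -> is_derive (log_sine_ratio z) t (cos t / sin t).
Proof.
  intros Hz Ht. pose proof (sin_gt_0 z ltac:(lra) ltac:(lra)).
  pose proof (sin_gt_0 t ltac:(lra) ltac:(lra)). unfold log_sine_ratio.
  auto_derive.
  - now apply Rdiv_lt_0_compat.
  - field. lra.
Qed.

Lemma log_sine_ratio_self z : 0 < z < PI / 2 -> log_sine_ratio z z = 0.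
Proof.
  intros Hz. pose proof (sin_gt_0 z ltac:(lra) ltac:(lra)). unfold log_sine_ratio.
  rewrite <- ln_1. f_equal. field. lra.
Qed.

(** The integral is improper at 0; continuity of the antiderivative there turns
    it into a limit of ordinary ones. *)
Lemma ls_antiderivative m z (G : R -> R) :
  0 < z < PI / 2 ->
  continuous G 0 -> G 0 = 0 ->
  (forall t, 0 < t < PI / 2 -> is_derive G t (t * log_sine_ratio z t ^ (m - 2))) ->
  ls m 1 z = - G z.
Proof.
  intros Hz C0 G0 D. unfold ls. f_equal.
  apply is_RInt_gen_unique.
  apply (is_RInt_gen_ext (Derive G)).
  { exists (fun x => 0 < x < z) (fun x => x = z).
    - exists (mkposreal z (proj1 Hz)). intros y Hy Hy0. change (Rabs (y - 0) < z) in Hy.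
      rewrite Rminus_0_r, Rabs_pos_eq in Hy; lra.
    - reflexivity.
    - intros x y Hx ->. cbn [fst snd]. rewrite Rmin_left, Rmax_right by lra. intros t Ht.
      rewrite (is_derive_unique _ _ _ (D t ltac:(lra))), pow_1.
      replace (m - 1 - 1)%nat with (m - 2)%nat by lia. reflexivity. }
  replace (G z) with (G z - 0) by ring.
  assert (B : filter_prod (at_right 0) (at_point z) (fun ab => forall x,
      Rmin (fst ab) (snd ab) <= x <= Rmax (fst ab) (snd ab) -> 0 < x < PI / 2)).
  { exists (fun x => 0 < x < z) (fun x => x = z).
    - exists (mkposreal z (proj1 Hz)). intros y Hy Hy0. change (Rabs (y - 0) < z) in Hy.
      rewrite Rminus_0_r, Rabs_pos_eq in Hy; lra.
    - reflexivity.
    - intros x y Hx ->. cbn [fst snd]. rewrite Rmin_left, Rmax_right by lra. intros t Ht. lra. }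
  apply is_RInt_gen_Derive.
  - revert B. apply filter_imp. intros ab H x Hx. eexists. apply D, H, Hx.
  - revert B. apply filter_imp. intros ab H x Hx. specialize (H x Hx).
    apply (continuous_ext_loc _ (fun t => t * log_sine_ratio z t ^ (m - 2))).
    + assert (Hm : 0 < Rmin x (PI / 2 - x)) by (apply Rmin_pos; lra).
      exists (mkposreal _ Hm). intros y Hy. change (Rabs (y - x) < Rmin x (PI / 2 - x)) in Hy.
      pose proof (Rmin_l x (PI / 2 - x)). pose proof (Rmin_r x (PI / 2 - x)).
      apply Rabs_def2 in Hy. symmetry. apply is_derive_unique, D. lra.
    + apply (continuous_mult (K := R_AbsRing) (fun t => t)); [apply continuous_id|].
      apply (ex_derive_continuous (V := R_NormedModule)).
      eexists. apply (is_derive_pow _ (m - 2) _ _ (log_sine_ratio_derive z x Hz H)).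
  - now apply tends0_continuous.
  - intros P HP. apply locally_singleton in HP. exact HP.
Qed.

(** The building blocks of the antiderivatives of t * ln (sin t / sin z)^k. *)
Definition log_sine_term (a : R) (p k : nat) (z t : R) : R :=
  a * (central_binomial_sum p t * log_sine_ratio z t ^ k).

Lemma log_sine_term_continuous_0 a p k z :
  0 < z < PI / 2 -> continuous (log_sine_term a p k z) 0.
Proof.
  intros Hz. apply (continuous_mult (K := R_AbsRing)); [apply continuous_const|].
  now apply central_binomial_log_continuous_0.
Qed.

Lemma log_sine_term_derive a p k z t :
  0 < z < PI / 2 -> 0 < t < PI / 2 ->
  is_derive (log_sine_term a (S p) k z) t
    (a * (cos t / sin t) * (2 * central_binomial_sum p t * log_sine_ratio z t ^ k +
        INR k * central_binomial_sum (S p) t * log_sine_ratio z t ^ pred k)).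
Proof.
  intros Hz Ht. evar_last.
  - apply (is_derive_scal (fun t => central_binomial_sum (S p) t * log_sine_ratio z t ^ k)).
    apply (is_derive_mult (K := R_AbsRing)).
    + apply central_binomial_sum_derive, Ht.
    + apply is_derive_pow, log_sine_ratio_derive; assumption.
    + intros; apply Rmult_comm.
  - unfold plus, mult; simpl. ring.
Qed.

(** The case p = 2 produces the integrand, because cot t * T_1(t) = 2 t. *)
Lemma log_sine_term_2_derive a k z t :
  0 < z < PI / 2 -> 0 < t < PI / 2 ->
  is_derive (log_sine_term a 2 k z) t
    (a * (4 * t * log_sine_ratio z t ^ k +
        (cos t / sin t) * INR k * central_binomial_sum 2 t * log_sine_ratio z t ^ pred k)).
Proof.
  intros Hz Ht. evar_last; [apply log_sine_term_derive; assumption|].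
  assert (E : cos t / sin t * central_binomial_sum 1 t = 2 * t).
  { rewrite <- (sin_cos_PSeries t Ht). unfold central_binomial_sum.
    rewrite central_binomial_gf_factor. pose proof (sin_gt_0 t ltac:(lra) ltac:(lra)). field. lra. }
  replace (4 * t) with (2 * (2 * t)) by ring. rewrite <- E. ring.
Qed.

Lemma log_sine_term_self a p k z : 0 < z < PI / 2 -> (0 < k)%nat -> log_sine_term a p k z z = 0.
Proof.
  intros Hz Hk. unfold log_sine_term. rewrite log_sine_ratio_self, pow_i by assumption. ring.
Qed.

Lemma log_sine_term_at_0 a p k z : log_sine_term a p k z 0 = 0.
Proof. unfold log_sine_term. rewrite central_binomial_sum_0. ring. Qed.

(** In this and the next two antiderivatives, the first coefficient 1/4 makes the
    derivative produce t L^k, and each further one is minus half the preceding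
    one times the exponent of L, so that the cot t terms cancel in pairs. *)
Lemma ls_3_1 z : 0 < z < PI / 2 -> ls 3 1 z = 1 / 8 * central_binomial_sum 3 z.
Proof.
  intros Hz.
  rewrite (ls_antiderivative 3 z (fun t =>
    log_sine_term (1 / 4) 2 1 z t + log_sine_term (- 1 / 8) 3 0 z t)); [| exact Hz | | |].
  - rewrite log_sine_term_self by (assumption || lia).
    unfold log_sine_term. simpl. field.
  - apply continuous_Rplus; now apply log_sine_term_continuous_0.
  - rewrite !log_sine_term_at_0; ring.
  - intros t Ht. evar_last.
    + apply is_derive_Rplus; [apply log_sine_term_2_derive|apply log_sine_term_derive]; assumption.
    + pose proof (sin_gt_0 t ltac:(lra) ltac:(lra)). simpl. field. lra.
Qed.

Lemma ls_4_1 z : 0 < z < PI / 2 -> ls 4 1 z = - (1 / 8) * central_binomial_sum 4 z.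
Proof.
  intros Hz.
  rewrite (ls_antiderivative 4 z (fun t =>
    log_sine_term (1 / 4) 2 2 z t + log_sine_term (- 1 / 4) 3 1 z t
    + log_sine_term (1 / 8) 4 0 z t)); [| exact Hz | | |].
  - rewrite !log_sine_term_self by (assumption || lia).
    unfold log_sine_term. simpl. field.
  - apply continuous_Rplus; [apply continuous_Rplus|]; now apply log_sine_term_continuous_0.
  - rewrite !log_sine_term_at_0; ring.
  - intros t Ht. evar_last.
    + apply is_derive_Rplus; [apply is_derive_Rplus; [apply log_sine_term_2_derive|apply log_sine_term_derive]
        |apply log_sine_term_derive]; assumption.
    + pose proof (sin_gt_0 t ltac:(lra) ltac:(lra)). simpl. field. lra.
Qed.

Lemma ls_5_1 z : 0 < z < PI / 2 -> ls 5 1 z = 3 / 16 * central_binomial_sum 5 z.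
Proof.
  intros Hz.
  rewrite (ls_antiderivative 5 z (fun t =>
    log_sine_term (1 / 4) 2 3 z t + log_sine_term (- 3 / 8) 3 2 z t
    + log_sine_term (3 / 8) 4 1 z t + log_sine_term (- 3 / 16) 5 0 z t)); [| exact Hz | | |].
  - rewrite !log_sine_term_self by (assumption || lia).
    unfold log_sine_term. simpl. field.
  - apply continuous_Rplus; [apply continuous_Rplus; [apply continuous_Rplus|]|];
      now apply log_sine_term_continuous_0.
  - rewrite !log_sine_term_at_0; ring.
  - intros t Ht. evar_last.
    + apply is_derive_Rplus; [apply is_derive_Rplus; [apply is_derive_Rplus|]|];
        [apply log_sine_term_2_derive|apply log_sine_term_derive ..]; assumption.
    + pose proof (sin_gt_0 t ltac:(lra) ltac:(lra)). simpl. field. lra.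
Qed.

(** * Polylogarithms near the unit circle *)

Lemma ex_series_inv_sqr : ex_series (fun n => / INR (S n) ^ 2).
Proof.
  (* Comparison with a telescoping series. *)
  apply (ex_series_le (V := R_CompleteNormedModule) _ (fun n => 2 * (/ INR (S n) - / INR (S (S n))))).
  - intros n. change (Rabs (/ INR (S n) ^ 2) <= 2 * (/ INR (S n) - / INR (S (S n)))).
    rewrite !S_INR. pose proof (pos_INR n).
    rewrite Rabs_pos_eq by (left; apply Rinv_0_lt_compat, pow_lt; lra).
    replace (2 * (/ (INR n + 1) - / (INR n + 1 + 1))) with (2 / ((INR n + 1) * (INR n + 2))) by (field; lra).
    apply Rmult_le_reg_r with ((INR n + 1) ^ 2 * (INR n + 2)).
    + apply Rmult_lt_0_compat; [apply pow_lt|]; lra.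
    + replace (/ (INR n + 1) ^ 2 * ((INR n + 1) ^ 2 * (INR n + 2))) with (INR n + 2) by (field; lra).
      replace (2 / ((INR n + 1) * (INR n + 2)) * ((INR n + 1) ^ 2 * (INR n + 2))) with (2 * (INR n + 1)) by (field; lra).
      lra.
  - apply (ex_series_scal (V := R_NormedModule) 2).
    exists 1.
    assert (E : forall N, 1 - / INR (S (S N)) = sum_n (fun n => / INR (S n) - / INR (S (S n))) N).
    { induction N as [|N IH]; [rewrite sum_O; simpl; field|].
      rewrite sum_Sn, <- IH. unfold plus; simpl plus.
      change (1 - / INR (S (S (S N))) = (1 - / INR (S (S N))) + (/ INR (S (S N)) - / INR (S (S (S N))))). ring. }
    apply (is_lim_seq_ext _ _ 1 E).
    evar_last.
    + apply is_lim_seq_minus'; [apply is_lim_seq_const|].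
      apply (proj1 (is_lim_seq_incr_1 (fun n => / INR (S n)) 0)), is_lim_seq_inv_INR_S.
    + f_equal; ring.
Qed.

Lemma inv_pow_le_inv_sqr m n : (2 <= m)%nat -> / INR (S n) ^ m <= / INR (S n) ^ 2.
Proof.
  intros Hm. apply Rinv_le_contravar; [apply pow_lt, lt_0_INR; lia|].
  apply Rle_pow; [|exact Hm]. pose proof (pow_INR_S_ge_1 n 1) as H. now rewrite pow_1 in H.
Qed.

Lemma ex_series_inv_pow m : (2 <= m)%nat -> ex_series (fun n => / INR (S n) ^ m).
Proof.
  intros Hm. apply (ex_series_le (V := R_CompleteNormedModule) _ (fun n => / INR (S n) ^ 2)); [|apply ex_series_inv_sqr].
  intros n. change (Rabs (/ INR (S n) ^ m) <= / INR (S n) ^ 2).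
  rewrite Rabs_pos_eq by (left; apply Rinv_0_lt_compat, pow_lt, lt_0_INR; lia).
  now apply inv_pow_le_inv_sqr.
Qed.

Lemma zeta_INR m : zeta (INR m) = Series (fun n => / INR (S n) ^ m).
Proof.
  apply Series_ext. intros n. rewrite Rpower_pow; [reflexivity|apply lt_0_INR; lia].
Qed.

Lemma Cmod_pow_minus_1 (x : C) n : Cmod x <= 1 -> Cmod (x ^ n - 1) <= INR n * Cmod (x - 1).
Proof.
  intros Hx. induction n as [|n IH].
  - simpl Cpow. replace (1 - 1)%C with (RtoC 0) by ring. rewrite Cmod_0. simpl; lra.
  - rewrite S_INR, Cpow_S. replace (x * x ^ n - 1)%C with (x * (x ^ n - 1) + (x - 1))%C by ring.
    eapply Rle_trans; [apply Cmod_triangle|]. rewrite Cmod_mult.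
    pose proof (Cmod_ge_0 (x ^ n - 1)). nra.
Qed.

Lemma Rabs_Series_le (u a : nat -> R) :
  (forall n, Rabs (u n) <= a n) -> ex_series a -> Rabs (Series u) <= Series a.
Proof.
  intros H Ha.
  assert (ex_series (fun n => Rabs (u n))).
  { apply (ex_series_le (V := R_CompleteNormedModule) _ a); [|exact Ha].
    intros n. change (Rabs (Rabs (u n)) <= a n). now rewrite Rabs_Rabsolu. }
  eapply Rle_trans; [now apply Series_Rabs|].
  apply Series_le; [|exact Ha]. intros n; split; [apply Rabs_pos|apply H].
Qed.

(** Termwise |x^n - 1| <= n |x - 1| on the closed disk; one power of n is lost,
    which weight at least 3 can afford. *)
Lemma polylog_near_1 m x d :
  (3 <= m)%nat -> off_cut x d -> Cmod x <= 1 ->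
  Rabs (Re (polylog m x) - zeta (INR m)) <= Series (fun n => / INR (S n) ^ 2) * Cmod (x - 1) /\
  Rabs (Im (polylog m x)) <= Series (fun n => / INR (S n) ^ 2) * Cmod (x - 1).
Proof.
  intros Hm Hd Hx.
  assert (B : forall n, Cmod (x ^ S n / RtoC (INR (S n) ^ m) - RtoC (/ INR (S n) ^ m))
                        <= / INR (S n) ^ 2 * Cmod (x - 1)).
  { intros n. assert (Hn : 0 < INR (S n)) by (apply lt_0_INR; lia).
    assert (Hp : INR (S n) ^ m <> 0) by (apply pow_nonzero; lra).
    rewrite RtoC_inv by exact Hp.
    replace (x ^ S n / RtoC (INR (S n) ^ m) - / RtoC (INR (S n) ^ m))%C
      with ((x ^ S n - 1) * / RtoC (INR (S n) ^ m))%C by (unfold Cdiv; ring).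
    rewrite <- RtoC_inv by exact Hp. rewrite Cmod_mult, Cmod_RtoC_nonneg by (left; now apply Rinv_0_lt_compat, pow_lt).
    pose proof (Cmod_pow_minus_1 x (S n) Hx) as E.
    assert (HI : 0 < / INR (S n) ^ m) by (now apply Rinv_0_lt_compat, pow_lt).
    apply Rle_trans with (INR (S n) * Cmod (x - 1) * / INR (S n) ^ m); [apply Rmult_le_compat_r; lra|].
    replace (INR (S n) * Cmod (x - 1) * / INR (S n) ^ m) with (/ INR (S n) ^ (m - 1) * Cmod (x - 1)).
    - apply Rmult_le_compat_r; [apply Cmod_ge_0|]. apply inv_pow_le_inv_sqr. lia.
    - replace m with (S (m - 1)) at 2 by lia. rewrite <- tech_pow_Rmult. field.
      split; [apply pow_nonzero|]; lra. }
  destruct (C_series_Re_Im _ _ (polylog_series m x d ltac:(lia) Hd Hx)) as [SR SI].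
  assert (Hz : ex_series (fun n => / INR (S n) ^ m)) by (apply ex_series_inv_pow; lia).
  assert (Hs : ex_series (fun n => / INR (S n) ^ 2 * Cmod (x - 1))).
  { apply ex_series_scal_r, ex_series_inv_sqr. }
  rewrite <- Series_scal_r. split.
  - rewrite zeta_INR, <- (is_series_unique _ _ SR), <- Series_minus by (assumption || (eexists; exact SR)).
    apply Rabs_Series_le; [|exact Hs]. intros n. eapply Rle_trans; [|apply B].
    eapply Rle_trans; [|apply re_le_Cmod]. right; reflexivity.
  - rewrite <- (is_series_unique _ _ SI).
    apply Rabs_Series_le; [|exact Hs]. intros n. eapply Rle_trans; [|apply B].
    eapply Rle_trans; [|apply im_le_Cmod]. right; f_equal.
    match goal with |- Im ?w = Im (?w - RtoC ?r)%C => change (Im w = Im w + - 0) end. ring.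
Qed.

Lemma CInt_conj f l : is_CInt f l -> is_CInt (fun v => Cconj (f v)) (Cconj l).
Proof.
  intros [H1 H2]. split; [exact H1|]. exact (is_RInt_opp _ _ _ _ H2).
Qed.

Lemma polylog_conj m x : slit_plane x -> polylog m (Cconj x) = Cconj (polylog m x).
Proof.
  intros Hx. destruct (slit_plane_off_cut x Hx) as [d Hd]. unfold polylog.
  rewrite Cmult_conj. f_equal. apply is_CInt_unique.
  eapply is_CInt_ext; [|apply CInt_conj, is_CInt_weighted].
  - intros v Hv. cbv beta.
    assert (Na : cut_factor x v <> 0%C) by (apply off_cut_neq0 with d; [assumption|lra]).
    rewrite Cmult_conj, Cinv_conj by exact Na.
    unfold cut_factor. rewrite Cminus_conj, Cmult_conj.
    f_equal; [|f_equal; f_equal; [|f_equal]]; apply injective_projections; simpl; ring.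
  - intros v Hv. now apply C_continuous_inv_cut_factor with d.
Qed.

(** The real part of 2 v x / (1 - x v^2) is the derivative of - ln |1 - x v^2|. *)
Lemma Re_polylog_1 x : slit_plane x -> Re (polylog 1 x) = - ln (Cmod (1 - x)).
Proof.
  intros Hx. destruct (slit_plane_off_cut x Hx) as [d Hd].
  set (q := fun v => (1 - Re x * v ^ 2) ^ 2 + (Im x * v ^ 2) ^ 2).
  assert (Hq : forall v, 0 <= v <= 1 -> 0 < q v).
  { intros v Hv. pose proof (Csqr_norm_neq0 _ (off_cut_neq0 x d v Hd Hv)) as N.
    replace (fst (cut_factor x v) ^ 2 + snd (cut_factor x v) ^ 2) with (q v) in N
      by (unfold q, cut_factor, Re, Im; simpl; ring).
    assert (0 <= q v) by (unfold q; apply Rplus_le_le_0_compat; apply pow2_ge_0). lra. }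
  set (h := fun v => (x * (RtoC (log_weight 0 v) * / cut_factor x v))%C).
  assert (Q : is_CInt h (polylog 1 x)).
  { apply is_CInt_scal, is_CInt_weighted. intros v Hv. now apply C_continuous_inv_cut_factor with d. }
  assert (Ch : forall v, 0 <= v <= 1 -> C_continuous h v).
  { intros v Hv. apply C_continuous_mult; [apply C_continuous_const|]. apply C_continuous_mult.
    - apply C_continuous_RtoC, log_weight_continuous, Hv.
    - now apply C_continuous_inv_cut_factor with d. }
  rewrite <- (is_RInt_unique _ _ _ _ (proj1 Q)).
  apply is_RInt_unique.
  evar_last.
  - apply (is_RInt_derive (V := R_CompleteNormedModule) (fun v => - / 2 * ln (q v)));
      rewrite Rmin_left, Rmax_right by lra; intros v Hv.
    + pose proof (Hq v Hv) as P. unfold q in *. auto_derive.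
      * exact P.
      * unfold h, log_weight, cut_factor, Re, Im in *. simpl in *. field.
        repeat split; try lra.
    + apply (Ch v Hv).
  - unfold minus, plus, opp; simpl.
    replace (q 0) with 1 by (unfold q; ring). rewrite ln_1.
    replace (q 1) with (Cmod (1 - x) ^ 2).
    + assert (N1 : 0 < Cmod (1 - x)).
      { pose proof (proj2 Hd 1 ltac:(lra)) as H. unfold cut_factor in H. rewrite pow1, Cmult_1_r in H.
        destruct Hd; lra. }
      simpl pow. rewrite Rmult_1_r, ln_mult by assumption. field.
    + rewrite Cmod2_alt. unfold q, Re, Im. simpl. ring.
Qed.

(** * The curves traced by exp(-2iz) and 1 - exp(-2iz) *)

Definition circle_point (z : R) : C := (cos (2 * z), - sin (2 * z)).

Lemma Cexp_circle_point z : Cexp (RtoC (- 2 * z) * Ci)%C = circle_point z.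
Proof.
  unfold Cexp, circle_point, Re, Im, Ci; simpl.
  replace (-2 * z * 0 - 0 * 1) with 0 by ring. replace (-2 * z * 1 + 0 * 0) with (- (2 * z)) by ring.
  rewrite exp_0, cos_neg, sin_neg. f_equal; ring.
Qed.

Lemma circle_point_derive z : is_C_derive circle_point z (- (2 * Ci) * circle_point z)%C.
Proof.
  split; unfold circle_point, Re, Im; simpl; (auto_derive; [exact I|ring]).
Qed.

Lemma Cmod_circle_point z : Cmod (circle_point z) = 1.
Proof.
  unfold Cmod, circle_point; cbn [fst snd].
  replace (_ + _) with 1; [apply sqrt_1|].
  pose proof (sin2_cos2 (2 * z)) as H. unfold Rsqr in H. lra.
Qed.

Lemma circle_point_chord_derive z :
  is_C_derive (fun s => 1 - circle_point s)%C z (2 * Ci * circle_point z)%C.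
Proof.
  eapply is_C_derive_eq; [apply is_C_derive_minus; [apply is_C_derive_const|apply circle_point_derive]|].
  ring.
Qed.

(** The logarithmic derivative of 1 - exp(-2iz) is cot z - i; it is stated as a
    product to stay compatible with [polylog_int]. *)
Lemma circle_point_chord_velocity z :
  sin z <> 0 ->
  (2 * Ci * circle_point z)%C = ((1 - circle_point z) * (RtoC (cos z / sin z) - Ci))%C.
Proof.
  intros Hs. unfold circle_point. rewrite sin_2a, cos_2a.
  set (k := cos z / sin z).
  assert (Hk : cos z = k * sin z) by (unfold k; field; exact Hs).
  pose proof (sin2_cos2 z) as H. unfold Rsqr in H. rewrite Hk in *.
  apply injective_projections; simpl.
  - replace 1 with (sin z * sin z + k * sin z * (k * sin z)) at 3. ring.
  - replace 1 with (sin z * sin z + k * sin z * (k * sin z)) at 3. ring.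
Qed.

Lemma Cmod_circle_point_chord z : 0 <= sin z -> Cmod (1 - circle_point z) = 2 * sin z.
Proof.
  intros Hs. unfold Cmod. rewrite <- (sqrt_pow2 (2 * sin z)) by lra. f_equal.
  unfold circle_point; simpl. rewrite cos_2a_sin, sin_2a.
  pose proof (sin2_cos2 z) as H. unfold Rsqr in H.
  assert (E : cos z * cos z = 1 - sin z * sin z) by lra.
  replace (_ + _) with (4 * (sin z * sin z) * (sin z * sin z) + 4 * (sin z * sin z) * (cos z * cos z)) by ring.
  rewrite E; ring.
Qed.

Lemma circle_point_slit z : 0 < z < PI / 2 -> slit_plane (circle_point z).
Proof.
  intros Hz [_ H]. unfold circle_point, Im in H; simpl in H.
  pose proof (sin_gt_0 (2 * z) ltac:(lra) ltac:(lra)). lra.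
Qed.

Lemma circle_point_chord_slit z : 0 <= z < PI / 2 -> slit_plane (1 - circle_point z)%C.
Proof.
  intros [Hz Hz2] [H1 H]. unfold circle_point, Re, Im in *; simpl in *.
  destruct Hz as [Hz|<-].
  - pose proof (sin_gt_0 (2 * z) ltac:(lra) ltac:(lra)). lra.
  - rewrite Rmult_0_r, cos_0 in H1. lra.
Qed.

Definition ReW (m : nat) (z : R) : R := Re (polylog m (1 - circle_point z)).
Definition ImW (m : nat) (z : R) : R := Im (polylog m (1 - circle_point z)).
Definition ReE (m : nat) (z : R) : R := Re (polylog m (circle_point z)).
Definition ImE (m : nat) (z : R) : R := Im (polylog m (circle_point z)).

Lemma polylog_W_derive k z :
  0 < z < PI / 2 ->
  is_derive (ReW (S (S k))) z (cos z / sin z * ReW (S k) z + ImW (S k) z) /\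
  is_derive (ImW (S (S k))) z (cos z / sin z * ImW (S k) z - ReW (S k) z).
Proof.
  intros Hz. pose proof (sin_gt_0 z ltac:(lra) ltac:(lra)) as Hs.
  pose proof (polylog_derive k _ z _ (circle_point_chord_slit z ltac:(lra)) (circle_point_chord_derive z)) as D.
  rewrite circle_point_chord_velocity in D by lra.
  assert (E : (polylog_int k (1 - circle_point z) * ((1 - circle_point z) * (RtoC (cos z / sin z) - Ci)))%C
            = (polylog (S k) (1 - circle_point z) * (RtoC (cos z / sin z) - Ci))%C)
   by (unfold polylog; simpl pred; ring).
  rewrite E in D. destruct D as [D1 D2]. unfold ReW, ImW.
  destruct (polylog (S k) (1 - circle_point z)) as [a b]. unfold Re, Im in *. simpl in *.
  split; [evar_last; [exact D1|ring]|evar_last; [exact D2|ring]].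
Qed.

Lemma polylog_E_derive k z :
  0 < z < PI / 2 ->
  is_derive (ReE (S (S k))) z (2 * ImE (S k) z) /\
  is_derive (ImE (S (S k))) z (- 2 * ReE (S k) z).
Proof.
  intros Hz.
  pose proof (polylog_derive k _ z _ (circle_point_slit z ltac:(lra)) (circle_point_derive z)) as D.
  assert (E : (polylog_int k (circle_point z) * (- (2 * Ci) * circle_point z))%C
            = (polylog (S k) (circle_point z) * (- (2 * Ci)))%C)
   by (unfold polylog; simpl pred; ring).
  rewrite E in D. destruct D as [D1 D2]. unfold ReE, ImE.
  destruct (polylog (S k) (circle_point z)) as [a b]. unfold Re, Im in *. simpl in *.
  split; [evar_last; [exact D1|ring]|evar_last; [exact D2|ring]].
Qed.

Lemma polylog_W_1_derive z :
  0 <= z < PI / 2 -> is_derive (ReW 1) z 0 /\ is_derive (ImW 1) z 2.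
Proof.
  intros Hz.
  pose proof (polylog_1_derive _ z _ (circle_point_chord_slit z Hz) (circle_point_chord_derive z)) as D.
  assert (N : circle_point z <> 0%C).
  { intros Z. pose proof (Cmod_circle_point z) as H. rewrite Z, Cmod_0 in H. lra. }
  assert (E : (/ (1 - (1 - circle_point z)) * (2 * Ci * circle_point z))%C = (2 * Ci)%C).
  { replace (1 - (1 - circle_point z))%C with (circle_point z) by ring. field. exact N. }
  cbv beta in D. rewrite E in D. destruct D as [D1 D2]. unfold Re, Im in D1, D2; simpl in D1, D2.
  split; [evar_last; [exact D1|ring]|evar_last; [exact D2|ring]].
Qed.

(** The curve 1 - exp(-2iz) passes through 0, an interior point of the slit plane,
    so the limit is a value. *)
Lemma polylog_W_tends0 k : tends0 (ReW (S k)) 0 /\ tends0 (ImW (S k)) 0.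
Proof.
  pose proof PI_RGT_0.
  assert (Cc : C_continuous (fun z => polylog (S k) (1 - circle_point z))%C 0).
  { pose proof (circle_point_chord_slit 0 ltac:(lra)) as S0.
    destruct k as [|k]; eapply is_C_derive_continuous.
    - apply polylog_1_derive; [exact S0|apply circle_point_chord_derive].
    - apply polylog_derive; [exact S0|apply circle_point_chord_derive]. }
  assert (V : polylog (S k) (1 - circle_point 0)%C = 0%C).
  { unfold polylog. replace (1 - circle_point 0)%C with (RtoC 0); [ring|].
    unfold circle_point. rewrite Rmult_0_r, cos_0, sin_0. apply injective_projections; simpl; ring. }
  split; apply tends0_continuous; try apply Cc.
  - unfold ReW. now rewrite V.
  - unfold ImW. now rewrite V.
Qed.

(** The point 1 lies on the cut, so this limit rests on the series on the circle. *)
Lemma polylog_E_tends0 m :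
  (3 <= m)%nat -> tends0 (ReE m) (zeta (INR m)) /\ tends0 (ImE m) 0.
Proof.
  intros Hm. pose proof PI_RGT_0.
  set (S2 := Series (fun n => / INR (S n) ^ 2)).
  assert (L : tends0 (fun z => S2 * (2 * sin z)) 0).
  { apply tends0_continuous.
    - apply (ex_derive_continuous (V := R_NormedModule)). auto_derive; exact I.
    - rewrite sin_0; ring. }
  assert (B : forall z, 0 < z < PI / 2 ->
    Rabs (ReE m z - zeta (INR m)) <= S2 * (2 * sin z) /\ Rabs (ImE m z - 0) <= S2 * (2 * sin z)).
  { intros z Hz. destruct (slit_plane_off_cut _ (circle_point_slit z Hz)) as [d Hd].
    pose proof (sin_gt_0 z ltac:(lra) ltac:(lra)).
    rewrite Rminus_0_r, <- Cmod_circle_point_chord by lra.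
    replace (Cmod (1 - circle_point z)) with (Cmod (circle_point z - 1))
      by (rewrite <- Cmod_opp; f_equal; ring).
    apply (polylog_near_1 m _ d Hm Hd). rewrite Cmod_circle_point; lra. }
  split; apply (tends0_squeeze _ _ _ (PI / 2) ltac:(lra)) with (2 := L); intros z Hz; apply B, Hz.
Qed.

Lemma ReE_1 z : 0 < z < PI / 2 -> ReE 1 z = - ln (2 * sin z).
Proof.
  intros Hz. pose proof (sin_gt_0 z ltac:(lra) ltac:(lra)).
  unfold ReE. rewrite Re_polylog_1 by now apply circle_point_slit.
  now rewrite Cmod_circle_point_chord by lra.
Qed.

Lemma ReW_derive k z :
  0 < z < PI / 2 ->
  is_derive (ReW (S (S k))) z (cos z / sin z * ReW (S k) z + ImW (S k) z).
Proof. intros Hz. exact (proj1 (polylog_W_derive k z Hz)). Qed.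

Lemma ImW_derive k z :
  0 < z < PI / 2 ->
  is_derive (ImW (S (S k))) z (cos z / sin z * ImW (S k) z - ReW (S k) z).
Proof. intros Hz. exact (proj2 (polylog_W_derive k z Hz)). Qed.

Lemma ReE_derive k z :
  0 < z < PI / 2 -> is_derive (ReE (S (S k))) z (2 * ImE (S k) z).
Proof. intros Hz. exact (proj1 (polylog_E_derive k z Hz)). Qed.

Lemma ImE_derive k z :
  0 < z < PI / 2 -> is_derive (ImE (S (S k))) z (- 2 * ReE (S k) z).
Proof. intros Hz. exact (proj2 (polylog_E_derive k z Hz)). Qed.

Lemma ReW_tends0 k : tends0 (ReW (S k)) 0.
Proof. exact (proj1 (polylog_W_tends0 k)). Qed.

Lemma ImW_tends0 k : tends0 (ImW (S k)) 0.
Proof. exact (proj2 (polylog_W_tends0 k)). Qed.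

(** * The three evaluations *)

Lemma ImW_1 z : 0 < z < PI / 2 -> ImW 1 z = 2 * z.
Proof.
  apply (eq_from_derive (ImW 1) (fun z => 2 * z) (fun _ => 2)).
  - intros x Hx. apply (proj2 (polylog_W_1_derive x ltac:(lra))).
  - intros x Hx. auto_derive; [exact I|ring].
  - exists 0. split; [apply ImW_tends0|].
    replace 0 with (2 * 0) by ring. apply tends0_mult; [apply tends0_const|apply tends0_id].
Qed.

Lemma ReW_1 z : 0 < z < PI / 2 -> ReW 1 z = 0.
Proof.
  apply (eq_from_derive (ReW 1) (fun z => 0) (fun _ => 0)).
  - intros x Hx. apply (proj1 (polylog_W_1_derive x ltac:(lra))).
  - intros x Hx. apply (is_derive_const (V := R_NormedModule)).
  - exists 0. split; [apply ReW_tends0|apply tends0_const].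
Qed.

Lemma ReW_2 z : 0 < z < PI / 2 -> ReW 2 z = z ^ 2.
Proof.
  apply (eq_from_derive (ReW 2) (fun z => z ^ 2) (fun z => 2 * z)).
  - intros x Hx. evar_last; [apply ReW_derive, Hx|]. rewrite ReW_1, ImW_1 by exact Hx. ring.
  - intros x Hx. auto_derive; [exact I|ring].
  - exists 0. split; [apply ReW_tends0|].
    replace 0 with (0 ^ 2) by ring. apply tends0_pow, tends0_id.
Qed.

Lemma ln_2_sin_derive z : 0 < z < PI / 2 -> is_derive (fun z => ln (2 * sin z)) z (cos z / sin z).
Proof.
  intros Hz. pose proof (sin_gt_0 z ltac:(lra) ltac:(lra)).
  auto_derive; [lra|field; lra].
Qed.

(** The difference of the two sides is constant.  At z = pi/6 the points W and E
    are conjugate, so the imaginary parts cancel, and ln (2 sin z) = 0. *)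
Lemma ImE_2_plus_ImW_2 z : 0 < z < PI / 2 -> ImE 2 z + ImW 2 z = 2 * z * ln (2 * sin z).
Proof.
  intros Hz. pose proof PI_RGT_0.
  set (f := fun z => ImE 2 z + ImW 2 z - 2 * z * ln (2 * sin z)).
  assert (Df : forall x, 0 < x < PI / 2 -> is_derive f x 0).
  { intros x Hx. evar_last.
    - apply is_derive_Rminus; [apply is_derive_Rplus|].
      + apply ImE_derive, Hx.
      + apply ImW_derive, Hx.
      + apply (is_derive_Rmult (fun z => 2 * z)); [|apply ln_2_sin_derive, Hx].
        instantiate (1 := 2). auto_derive; [exact I|ring].
    - simpl. rewrite ReE_1, ReW_1, ImW_1 by exact Hx. ring. }
  assert (Z : f (PI / 6) = 0).
  { unfold f. replace (2 * sin (PI / 6)) with 1 by (rewrite sin_PI6; field). rewrite ln_1.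
    assert (E : (1 - circle_point (PI / 6))%C = Cconj (circle_point (PI / 6))).
    { unfold circle_point. replace (2 * (PI / 6)) with (PI / 3) by field. rewrite cos_PI3.
      apply injective_projections; simpl; field. }
    unfold ImE, ImW. rewrite E, polylog_conj by (apply circle_point_slit; lra).
    unfold Im, Cconj; simpl. ring. }
  rewrite (constant_on_interval f (PI / 2) Df (PI / 6) z) in Z by lra. unfold f in Z. lra.
Qed.

(** Since sin (pi/6) = 1/2, ln (2 sin z) is the logarithm normalized at pi/6, and
    2 z^2 = T_2(z): the function is a multiple of an antiderivative term. *)
Lemma sqr_ln_2_sin_tends0 : tends0 (fun z => z ^ 2 * ln (2 * sin z)) 0.
Proof.
  pose proof PI_RGT_0.
  apply (tends0_ext (fun z => / 2 * (central_binomial_sum 2 z * log_sine_ratio (PI / 6) z ^ 1)) _ _ (PI / 2));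
    [lra| |].
  - intros z Hz. rewrite central_binomial_sum_2 by exact Hz. unfold log_sine_ratio.
    rewrite sin_PI6. replace (sin z / (1 / 2)) with (2 * sin z) by field. field.
  - replace 0 with (/ 2 * 0) by ring. apply tends0_mult; [apply tends0_const|].
    apply tends0_continuous; [apply central_binomial_log_continuous_0; lra|].
    rewrite central_binomial_sum_0; ring.
Qed.

(** The derivatives agree by [ImE_2_plus_ImW_2] and Re Li_2(W) = z^2; the constant
    zeta(3) is the limit of Re Li_3(E). *)
Lemma ReE_3_plus_ReW_3 z :
  0 < z < PI / 2 -> ReE 3 z + 2 * ReW 3 z = 2 * (z ^ 2 * ln (2 * sin z)) + zeta 3.
Proof.
  apply (eq_from_derive (fun z => ReE 3 z + 2 * ReW 3 z) (fun z => 2 * (z ^ 2 * ln (2 * sin z)) + zeta 3)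
    (fun z => 4 * z * ln (2 * sin z) + 2 * z ^ 2 * (cos z / sin z))).
  - intros x Hx. evar_last.
    + apply is_derive_Rplus; [apply ReE_derive, Hx|].
      apply (is_derive_Rmult (fun _ => 2)); [apply (is_derive_const (V := R_NormedModule))|apply ReW_derive, Hx].
    + unfold zero; simpl. rewrite ReW_2 by exact Hx.
      pose proof (ImE_2_plus_ImW_2 x Hx). lra.
  - intros x Hx. evar_last.
    + apply is_derive_Rplus; [|apply (is_derive_const (V := R_NormedModule))].
      apply (is_derive_Rmult (fun _ => 2)); [apply (is_derive_const (V := R_NormedModule))|].
      apply (is_derive_Rmult (fun z => z ^ 2)); [|apply ln_2_sin_derive, Hx].
      instantiate (1 := 2 * x). auto_derive; [exact I|ring].
    + unfold zero; simpl. ring.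
  - exists (zeta 3). split.
    + replace (zeta 3) with (zeta (INR 3) + 2 * 0) by (replace (INR 3) with 3 by (simpl; ring); ring).
      apply tends0_plus; [apply (proj1 (polylog_E_tends0 3 ltac:(lia)))|].
      apply tends0_mult; [apply tends0_const|apply ReW_tends0].
    + evar_last.
      * apply tends0_plus; [|apply tends0_const].
        apply tends0_mult; [apply tends0_const|apply sqr_ln_2_sin_tends0].
      * ring.
Qed.

Lemma central_binomial_sum_tends0 p : tends0 (central_binomial_sum (S p)) 0.
Proof.
  pose proof PI_RGT_0.
  apply tends0_continuous; [|apply central_binomial_sum_0].
  apply (ex_derive_continuous (V := R_NormedModule)). eexists.
  apply central_binomial_sum_derive_PSeries. lra.
Qed.

Lemma central_binomial_sum_3 z :
  0 < z < PI / 2 -> 1 / 8 * central_binomial_sum 3 z = / 2 * (z * ImW 2 z) - / 2 * ReW 3 z.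
Proof.
  apply (eq_from_derive (fun z => 1 / 8 * central_binomial_sum 3 z)
    (fun z => / 2 * (z * ImW 2 z) - / 2 * ReW 3 z) (fun z => cos z / sin z * z ^ 2 / 2)).
  - intros x Hx. evar_last; [apply is_derive_Rscal, central_binomial_sum_derive, Hx|].
    rewrite central_binomial_sum_2 by exact Hx. unfold Rdiv; field.
    pose proof (sin_gt_0 x ltac:(lra) ltac:(lra)). lra.
  - intros x Hx. evar_last.
    + apply is_derive_Rminus; apply is_derive_Rscal.
      * apply (is_derive_Rmult (fun z => z)); [apply (is_derive_id (K := R_AbsRing))|apply ImW_derive, Hx].
      * apply ReW_derive, Hx.
    + unfold one; simpl. rewrite ReW_1, ImW_1, ReW_2 by exact Hx. field.
      pose proof (sin_gt_0 x ltac:(lra) ltac:(lra)). lra.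
  - exists 0. split.
    + replace 0 with (1 / 8 * 0) by ring. apply tends0_scal, central_binomial_sum_tends0.
    + replace 0 with (/ 2 * (0 * 0) - / 2 * 0) by ring.
      apply tends0_minus; apply tends0_scal;
        [apply tends0_mult; [apply tends0_id|apply ImW_tends0]|apply ReW_tends0].
Qed.

Lemma central_binomial_sum_4 z :
  0 < z < PI / 2 ->
  - (1 / 8) * central_binomial_sum 4 z = - (1 / 4) * z ^ 4 + ReW 4 z - z * ImW 3 z.
Proof.
  apply (eq_from_derive (fun z => - (1 / 8) * central_binomial_sum 4 z)
    (fun z => - (1 / 4) * z ^ 4 + ReW 4 z - z * ImW 3 z)
    (fun z => cos z / sin z * (ReW 3 z - z * ImW 2 z))).
  - intros x Hx. evar_last; [apply is_derive_Rscal, central_binomial_sum_derive, Hx|].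
    pose proof (central_binomial_sum_3 x Hx).
    replace (central_binomial_sum 3 x) with (8 * (1 / 8 * central_binomial_sum 3 x)) by field.
    rewrite H. field. pose proof (sin_gt_0 x ltac:(lra) ltac:(lra)). lra.
  - intros x Hx. evar_last.
    + apply is_derive_Rminus; [apply is_derive_Rplus|].
      * apply is_derive_Rscal. instantiate (1 := 4 * x ^ 3). auto_derive; [exact I|ring].
      * apply ReW_derive, Hx.
      * apply (is_derive_Rmult (fun z => z)); [apply (is_derive_id (K := R_AbsRing))|apply ImW_derive, Hx].
    + unfold one; simpl. rewrite ReW_2 by exact Hx. field.
      pose proof (sin_gt_0 x ltac:(lra) ltac:(lra)). lra.
  - exists 0. split.
    + replace 0 with (- (1 / 8) * 0) by ring. apply tends0_scal, central_binomial_sum_tends0.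
    + replace 0 with (- (1 / 4) * 0 ^ 4 + 0 - 0 * 0) by ring.
      apply tends0_minus; [apply tends0_plus|apply tends0_mult; [apply tends0_id|]].
      * apply tends0_scal, tends0_pow, tends0_id.
      * apply ReW_tends0.
      * apply ImW_tends0.
Qed.

(** In the derivative of the right side the terms without cot z add up to
    3 z / 2 times the difference of the sides of [ReE_3_plus_ReW_3]; the cot z
    terms reproduce the weight 4 identity. *)
Lemma central_binomial_sum_5 z :
  0 < z < PI / 2 ->
  3 / 16 * central_binomial_sum 5 z =
    3 / 4 * (z ^ 4 * ln (2 * sin z)) + 3 / 8 * zeta 5 + 3 / 4 * zeta 3 * z ^ 2
    + 3 / 4 * (z * (ImE 4 z + 4 * ImW 4 z)) - 3 / 8 * (ReE 5 z + 8 * ReW 5 z).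
Proof.
  apply (eq_from_derive (fun z => 3 / 16 * central_binomial_sum 5 z)
    (fun z => 3 / 4 * (z ^ 4 * ln (2 * sin z)) + 3 / 8 * zeta 5 + 3 / 4 * zeta 3 * z ^ 2
      + 3 / 4 * (z * (ImE 4 z + 4 * ImW 4 z)) - 3 / 8 * (ReE 5 z + 8 * ReW 5 z))
    (fun z => 3 * (cos z / sin z) * (1 / 4 * z ^ 4 - ReW 4 z + z * ImW 3 z))).
  - intros x Hx. evar_last; [apply is_derive_Rscal, central_binomial_sum_derive, Hx|].
    pose proof (central_binomial_sum_4 x Hx) as H.
    replace (central_binomial_sum 4 x) with (- 8 * (- (1 / 8) * central_binomial_sum 4 x)) by field.
    rewrite H. field. pose proof (sin_gt_0 x ltac:(lra) ltac:(lra)). lra.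
  - intros x Hx. evar_last.
    + apply is_derive_Rminus; [apply is_derive_Rplus; [apply is_derive_Rplus; [apply is_derive_Rplus|]|]
        |apply is_derive_Rscal, is_derive_Rplus].
      * apply is_derive_Rscal, (is_derive_Rmult (fun z => z ^ 4)); [|apply ln_2_sin_derive, Hx].
        instantiate (1 := 4 * x ^ 3). auto_derive; [exact I|ring].
      * apply (is_derive_const (V := R_NormedModule)).
      * apply is_derive_Rscal. instantiate (1 := 2 * x). auto_derive; [exact I|ring].
      * apply is_derive_Rscal, (is_derive_Rmult (fun z => z)); [apply (is_derive_id (K := R_AbsRing))|].
        apply is_derive_Rplus; [apply ImE_derive, Hx|apply is_derive_Rscal, ImW_derive, Hx].
      * apply ReE_derive, Hx.
      * apply is_derive_Rscal, ReW_derive, Hx.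
    + unfold one, zero; simpl one; simpl zero.
      pose proof (ReE_3_plus_ReW_3 x Hx) as H.
      replace (ReE 3 x) with (2 * (x ^ 2 * ln (2 * sin x)) + zeta 3 - 2 * ReW 3 x) by lra.
      simpl. field. pose proof (sin_gt_0 x ltac:(lra) ltac:(lra)). lra.
  - exists 0. split.
    + replace 0 with (3 / 16 * 0) by ring. apply tends0_scal, central_binomial_sum_tends0.
    + replace (zeta 5) with (zeta (INR 5)) by (f_equal; simpl; ring).
      replace 0 with (3 / 4 * (0 ^ 2 * 0) + 3 / 8 * zeta (INR 5) + 3 / 4 * zeta 3 * 0 ^ 2
        + 3 / 4 * (0 * (0 + 4 * 0)) - 3 / 8 * (zeta (INR 5) + 8 * 0)) by field.
      apply tends0_minus; [apply tends0_plus; [apply tends0_plus; [apply tends0_plus|]|]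
        |apply tends0_scal, tends0_plus].
      * apply tends0_scal. pose proof PI_RGT_0.
        apply (tends0_ext (fun z => z ^ 2 * (z ^ 2 * ln (2 * sin z))) _ _ 1); [lra|intros; ring|].
        apply tends0_mult; [apply tends0_pow, tends0_id|apply sqr_ln_2_sin_tends0].
      * apply tends0_const.
      * apply tends0_scal, tends0_pow, tends0_id.
      * apply tends0_scal, tends0_mult; [apply tends0_id|]. apply tends0_plus.
        -- apply (proj2 (polylog_E_tends0 4 ltac:(lia))).
        -- apply tends0_scal, ImW_tends0.
      * apply (proj1 (polylog_E_tends0 5 ltac:(lia))).
      * apply tends0_scal, ReW_tends0.
Qed.

Theorem corollary2p5 :
  forall z : R, 0 < z < PI / 2 ->
  let E : C := Cexp (RtoC (- 2 * z) * Ci)%C in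
  let W : C := (RtoC 1 - E)%C in
  (ex_series (central_binomial_term 3 z) /\
   ls 3 1 z = 1 / 8 * Series (central_binomial_term 3 z) /\
   1 / 8 * Series (central_binomial_term 3 z) =
     z / 2 * Im (Li 2 W) - 1 / 2 * Re (Li 3 W)) /\
  (ex_series (central_binomial_term 4 z) /\
   ls 4 1 z = - (1 / 8) * Series (central_binomial_term 4 z) /\
   - (1 / 8) * Series (central_binomial_term 4 z) =
     - (z ^ 4 / 4) + Re (Li 4 W) - z * Im (Li 3 W)) /\
  (ex_series (central_binomial_term 5 z) /\
   ls 5 1 z = 3 / 16 * Series (central_binomial_term 5 z) /\
   3 / 16 * Series (central_binomial_term 5 z) =
     3 * z ^ 4 / 4 * ln (2 * sin z) + 3 / 8 * zeta 5 + 3 * z ^ 2 / 4 * zeta 3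
     + 3 * z / 4 * (Im (Li 4 E) + 4 * Im (Li 4 W))
     - 3 / 8 * (Re (Li 5 E) + 8 * Re (Li 5 W))).
Proof.
  intros z Hz E W. unfold W, E. rewrite Cexp_circle_point.
  pose proof (circle_point_slit z Hz) as HE.
  pose proof (circle_point_chord_slit z ltac:(lra)) as HW.
  rewrite !Li_eq_polylog by (assumption || discriminate).
  assert (HS : forall p, is_series (central_binomial_term p z) (central_binomial_sum p z)).
  { intros p. apply central_binomial_sum_series. lra. }
  rewrite !(fun p => is_series_unique _ _ (HS p)).
  split; [|split]; (split; [eexists; apply HS|split]).
  - now apply ls_3_1.
  - rewrite central_binomial_sum_3 by exact Hz. unfold ImW, ReW. field.
  - now apply ls_4_1.
  - rewrite central_binomial_sum_4 by exact Hz. unfold ImW, ReW. field.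
  - now apply ls_5_1.
  - rewrite central_binomial_sum_5 by exact Hz. unfold ImW, ReW, ImE, ReE. field.
Qed.
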